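(* Let $q$ be a prime power, let $\mathscr{S}_T$ be a tangent splash of $\ell_\infty$ in $\mathrm{PG}(2,q^3)$ with centre $T$, and let $[\mathscr{S}_T]$ be the corresponding set of $q^2+1$ planes of the regular 2-spread $\mathcal{S}$ in $\Sigma_\infty\cong\mathrm{PG}(5,q)$ under the Bruck-Bose representation. Then there are exactly $q^2+q+1$ planes of $\Sigma_\infty$ that meet every plane of $[\mathscr{S}_T]$ (called cover planes). Each cover plane meets $[T]$ in a line, distinct cover planes meeting $[T]$ in distinct lines, and each cover plane meets every other plane of $[\mathscr{S}_T]$ in exactly one point; hence each cover plane is contained in the union of the planes of $[\mathscr{S}_T]$.
   Context: Bruck-Bose representation: $\Sigma_\infty$ is a hyperplane of $\mathrm{PG}(6,q)$ and $\mathcal{S}$ is a regular 2-spread of $\Sigma_\infty\cong\mathrm{PG}(5,q)$ (a partition of $\Sigma_\infty$ into $q^3+1$ planes such that for any three of its planes the unique 2-regulus containing them lies in $\mathcal{S}$; a 2-regulus is a set of $q+1$ pairwise disjoint planes such that any line meeting three of them meets all). Points of $\mathrm{PG}(6,q)\setminus\Sigma_\infty$ are the affine points of $\mathrm{PG}(2,q^3)$, lines of $\mathrm{PG}(2,q^3)$ other than $\ell_\infty$ are the 3-spaces of $\mathrm{PG}(6,q)$ not in $\Sigma_\infty$ containing a spread plane, and each point $X\in\ell_\infty$ corresponds to a spread plane $[X]\in\mathcal{S}$; for a set $Y\subseteq\ell_\infty$, $[Y]=\{[X]:X\in Y\}$. An order-$q$-subplane of $\mathrm{PG}(2,q^3)$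 is a subplane of order $q$; if it meets $\ell_\infty$ in exactly one point $T$, its tangent splash is the set of $q^2+1$ points of $\ell_\infty$ lying on extensions of its lines, with centre $T$.
   Formalization: Stated for prime powers q > 2 only: for q = 2 the claim is false, since some planes meeting every plane of the tangent splash meet [T] in a single point and are not contained in the union of its planes. *)

(* Defs.v *)
From HB Require Import structures.
From mathcomp Require Import all_boot all_order all_algebra.

Set Implicit Arguments.
Unset Strict Implicit.
Unset Printing Implicit Defensive.

Import VectorInternalTheory.

Local Open Scope ring_scope.

(* Subspaces of a finite space are stored as reduced matrices, so they form
   a finite type. *)
HB.instance Definition _ (L : finFieldType) (V : vectType L) :=
  [Countable of {vspace V} by <:].
HB.instance Definition _ (L : finFieldType) (V : vectType L) :=
  [Finite of {vspace V} by <:].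

(* The projective space PG(n, L) is the lattice of subspaces of L^(n+1);
   projective dimension is vector space dimension minus one, and the zero
   subspace is the empty flat. *)
Notation PG n L := {vspace 'rV[L]_(n.+1)}.

Section Flats.
Variables (n : nat) (L : finFieldType).
Implicit Types U W : PG n L.

Definition flats (k : nat) : {set PG n L} := [set U : PG n L | \dim U == k.+1].

Definition meets U W : bool := (U :&: W != 0)%VS.

Definition points_of U : {set PG n L} :=
  [set X in flats 0 | (X <= U)%VS].

End Flats.

Arguments flats {n L} k.

Notation points := (flats 0).
Notation lines := (flats 1).
Notation planes := (flats 2).
Notation solids := (flats 3).

Section Spreads.
Variables (n : nat) (L : finFieldType) (Sigma : PG n L).

Definition planes_in : {set PG n L} := [set P in planes | (P <= Sigma)%VS].

Definition regulus2 (R : {set PG n L}) : Prop :=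
  [/\ R \subset planes_in,
      #|R| = #|L|.+1,
      {in R &, forall P Q, P != Q -> ~~ meets P Q}
    & {in lines, forall l : PG n L,
        (2 < #|[set P in R | meets l P]|)%N -> {in R, forall P, meets l P}}].

Definition spread2 (S : {set PG n L}) : Prop :=
  [/\ S \subset planes_in,
      #|S| = (#|L| ^ 3).+1%N
    & {in points_of Sigma, forall X : PG n L,
        exists! P, P \in S /\ (X <= P)%VS}].

Definition regular_spread2 (S : {set PG n L}) : Prop :=
  spread2 S /\
  {in S & &, forall P1 P2 P3, uniq [:: P1; P2; P3] ->
     forall R, regulus2 R -> [set P1; P2; P3] \subset R -> R \subset S}.

(* The planes of Sigma meeting every member of A. *)
Definition cover_planes (A : {set PG n L}) : {set PG n L} :=
  [set P in planes_in | [forall Q in A, meets P Q]].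

End Spreads.

Definition bijects (A B : finType) (f : A -> B) (D : {set A}) (E : {set B}) :
  Prop := {in D &, injective f} /\ f @: D = E.

(* A single map bb sends points and lines of the plane PG(2, K), with K of
   order #|F| ^ 3, to flats of PG(6, F); for X on linf, bb X is the spread
   plane [X]. Its value on linf itself, and on 0 and the whole plane, is
   irrelevant. *)
Record bruck_bose (F K : finFieldType) (linf : PG 2 K) (Sigma : PG 6 F)
    (S : {set PG 6 F}) (bb : PG 2 K -> PG 6 F) : Prop := BruckBose {
  bb_linf : linf \in lines;
  bb_Sigma : Sigma \in flats 5;
  bb_spread : regular_spread2 Sigma S;
  bb_affine : bijects bb (points :\: points_of linf)
                         (points :\: points_of Sigma);
  bb_infinity : bijects bb (points_of linf) S;
  bb_lines : bijects bb (lines :\ linf)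
    [set W in solids | ~~ (W <= Sigma)%VS & [exists P in S, (P <= W)%VS]];
  bb_incidence : {in points & lines :\ linf, forall X l : PG 2 K,
    (X <= l)%VS = (bb X <= bb l)%VS}
}.

Section Subplanes.
Variables (K : finFieldType).
Implicit Types (B M ST : {set PG 2 K}) (linf T X l : PG 2 K).

(* B is the set of points and M the set of lines of the subplane. *)
Definition subplane (q : nat) B M : Prop :=
  [/\ B \subset points /\ M \subset lines,
      {in B &, forall X Y, X != Y ->
         exists2 l, l \in M & (X <= l)%VS && (Y <= l)%VS},
      {in M &, forall l m, l != m ->
         exists2 X, X \in B & (X <= l)%VS && (X <= m)%VS},
      (exists2 Q : {set PG 2 K}, Q \subset B /\ #|Q| = 4%N &
         {in lines, forall l, (#|Q :&: points_of l| <= 2)%N})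
    & {in M, forall l, #|B :&: points_of l| = q.+1}].

Definition splash linf M : {set PG 2 K} :=
  [set X in points_of linf | [exists l in M, (X <= l)%VS]].

Definition tangent_splash (q : nat) linf T ST : Prop :=
  exists B M, [/\ subplane q B M,
                  B :&: points_of linf = [set T]
                & ST = splash linf M].

End Subplanes.

(* Main.v *)
Require Import Defs.
From HB Require Import structures.
From mathcomp Require Import all_boot all_order all_algebra.
From mathcomp Require Import all_field ring zify.

(* The parallelogram rule makes [bb] on the affine points an additive bijection
   from [linf] onto [Sigma] that carries K-points to spread planes, and the
   F-scalars of [Sigma] then become multiplications by the elements of the
   subfield of order q of K. So [Sigma] is K^2, with T = {(m, 0)} and
   [u] = {(m u, m)}.

   The affine coordinates of a subplane on a line through T form a set of q
   elements whose nonzero part is closed under products, so it is that same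
   subfield; hence the points of the splash other than T are the u in a
   2-dimensional F-subspace U of K.

   The planes {(k u, k a) : u in U, a in F}, for k in K* / F*, are cover planes.
   A cover plane that is not of this form meets T in a single point (w, 0) and
   has a 2-dimensional projection to the second coordinate. Each of the q + 1
   points h of that projection accounts for at most q values u in U, and for at
   most one unless w / h lies in U. Since q > 2, three points h have w / h in U,
   and this makes a ratio of two of them quadratic over F, which is impossible
   in a cubic extension. *)

Set Implicit Arguments.
Unset Strict Implicit.
Unset Printing Implicit Defensive.

Import GRing.Theory.

Local Open Scope ring_scope.

(** * The subfield of order q *)

(** [A] consists of [q] roots of [X^q - X], and there can be no others. *)
Lemma mem_expf_fixed (K : finFieldType) (q : nat) (A : {set K}) (x : K) :
    (1 < q)%N -> #|A| = q -> {in A, forall y, y ^+ q = y} ->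
  x ^+ q = x -> x \in A.
Proof.
move=> q_gt1 cardA fixA fix_x.
pose p : {poly K} := 'X^q - 'X; pose Z := [set y : K | y ^+ q == y].
have sp : size p = q.+1 by rewrite size_polyDl size_polyXn // size_polyN size_polyX.
have p0 : p != 0 by rewrite -size_poly_eq0 sp.
have leZ : (#|Z| <= q)%N.
  rewrite cardE -ltnS -sp; apply: max_poly_roots => //; last exact: enum_uniq.
  apply/allP => y; rewrite mem_enum inE => /eqP yq.
  by rewrite /root !hornerE yq subrr.
have /eqP -> : A == Z.
  rewrite eqEcard cardA leZ andbT; apply/subsetP => y Ay.
  by rewrite inE fixA.
by rewrite inE fix_x.
Qed.

(* Multiplication by [x] permutes [A], so both sides have the same product. *)
Lemma expf_card_closed (K : finFieldType) (A : {set K}) (x : K) :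
    0 \notin A -> {in A &, forall y z, y * z \in A} -> x \in A ->
  x ^+ #|A| = 1.
Proof.
move=> A0 Amul Ax.
have nz y : y \in A -> y != 0 by apply: contraTneq => ->.
have injx : {in A &, injective ( *%R x)} by move=> y z _ _; apply/mulfI/nz.
have imA : [set x * y | y in A] = A.
  apply/eqP; rewrite eqEcard card_in_imset // leqnn andbT.
  by apply/subsetP => _ /imsetP[y Ay ->]; apply: Amul.
have prodnz : \prod_(y in A) y != 0 by apply/prodf_neq0 => y; apply: nz.
apply: (mulIf prodnz); rewrite mul1r -[in RHS]imA big_imset //=.
by rewrite big_split /= prodr_const.
Qed.

Section CubicExtension.
Variables (F K : finFieldType) (phi : {rmorphism F -> K}).
Hypothesis cardK : #|K| = (#|F| ^ 3)%N.

Lemma rmorph_expf_card c : phi c ^+ #|F| = phi c.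
Proof. by rewrite -rmorphXn expf_card. Qed.

(** The image of [phi] has [#|F|] elements, all fixed by this power map, so it is the whole fixed
    set. *)
Lemma expf_card_codom t : t ^+ #|F| = t -> t \in codom phi.
Proof.
move=> tF.
have := @mem_expf_fixed K #|F| [set phi c | c : F] t (finNzRing_gt1 F).
case/(_ _ _ tF)/imsetP; first by rewrite card_imset //; apply: fmorph_inj.
  by move=> _ /imsetP[c _ ->]; apply: rmorph_expf_card.
by move=> c _ ->; apply: codom_f.
Qed.

(** [#|F|] is a power of the characteristic. *)
Lemma exprD_card (x y : K) : (x + y) ^+ #|F| = x ^+ #|F| + y ^+ #|F|.
Proof.
have [p p_pr pF] := finPcharP F.
apply: exprDn_pchar; rewrite (eq_pnat _ (fmorph_pchar phi)) (card_pprimeChar pF).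
by rewrite pnatX (eq_pnat _ (pcharf_eq pF)) pnat_id.
Qed.

(* If [t] is not in the image of [phi], then [t] and [t ^+ #|F|] are the two
   roots, so the Frobenius map swaps them, although its cube is trivial. *)
Lemma quadratic_rmorph_eq0 t a b c : t \notin codom phi ->
  phi a * t ^+ 2 + phi b * t + phi c = 0 -> [/\ a = 0, b = 0 & c = 0].
Proof.
move=> tF; pose s (x : K) := x ^+ #|F|.
have sD x y : s (x + y) = s x + s y by apply: exprD_card.
have sM x y : s (x * y) = s x * s y by apply: exprMn.
have sphi d : s (phi d) = phi d by apply: rmorph_expf_card.
have st : s t - t != 0.
  by apply: contraNneq tF => /eqP; rewrite subr_eq0 => /eqP/expf_card_codom.
have s0 : s 0 = 0 by rewrite -(rmorph0 phi) sphi.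
have s3 : s (s (s t)) = t.
  by rewrite /s -!exprM -[RHS]expf_card cardK !expnS expn0 muln1 mulnA.
move=> quad.
have a0 : a = 0.
  apply/eqP/negPn/negP => a_neq0.
  (* Subtracting [quad] from its conjugate leaves the nonzero factor [s t - t], which is cancelled.
     Subtracting [lin] from its own conjugate then gives [s (s t) = t]. *)
  have lin : phi a * (s t + t) + phi b = 0.
    have squad : phi a * s t ^+ 2 + phi b * s t + phi c = 0.
      by have := congr1 s quad; rewrite s0 !sD !sM !sphi expr2.
    by apply: (mulfI st); rewrite mulr0 -[RHS](subrr 0) -{1}squad -quad; ring.
  have slin : phi a * (s (s t) + s t) + phi b = 0.
    by have := congr1 s lin; rewrite s0 sD sM sD !sphi.
  have ss : s (s t) = t.
    have pa : phi a != 0 by rewrite fmorph_eq0.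
    apply/eqP; rewrite -subr_eq0; apply/eqP/(mulfI pa).
    by rewrite mulr0 -[RHS](subrr 0) -{1}slin -lin; ring.
  by move: st; rewrite -{2}s3 ss subrr eqxx.
rewrite a0 rmorph0 mul0r add0r in quad.
have b0 : b = 0.
  apply/eqP/negPn/negP => b_neq0; case/negP: tF; apply/codomP; exists (- c / b).
  have pb : phi b != 0 by rewrite fmorph_eq0.
  apply: (mulfI pb); rewrite rmorphM fmorphV rmorphN mulrC.
  by move/eqP: quad; rewrite addr_eq0 mulrC => /eqP ->; field.
split=> //; move: quad; rewrite b0 rmorph0 mul0r add0r => /eqP.
by rewrite fmorph_eq0 => /eqP.
Qed.

End CubicExtension.

(** * Subplanes and tangent splashes *)

Section VectorSpace.
Variables (L : fieldType) (V : vectType L).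
Implicit Types (x y z v : V) (a b c : L).

Lemma mem_vlineD x y v :
  reflect (exists a b, v = a *: x + b *: y) (v \in <[x]> + <[y]>)%VS.
Proof.
apply: (iffP memv_addP) => [[_ /vlineP[a ->] [_ /vlineP[b ->] ->]]|[a [b ->]]].
  by exists a, b.
by exists (a *: x); [|exists (b *: y)]; rewrite ?memvZ ?memv_line.
Qed.

Lemma vline_eq x y : x != 0 -> x \in <[y]>%VS -> <[x]>%VS = <[y]>%VS.
Proof.
move=> x0 xy; apply/eqP; rewrite eqEdim -memvE xy !dim_vline x0.
by case: (y == 0).
Qed.

Lemma vlineZ a x : a != 0 -> <[a *: x]>%VS = <[x]>%VS.
Proof.
move=> a0; have [->|x0] := eqVneq x 0; first by rewrite scaler0.
by apply: vline_eq; rewrite ?scaler_eq0 ?negb_or ?a0 // memvZ ?memv_line.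
Qed.

Lemma dim_vlineD x y : x != 0 -> y \notin <[x]>%VS -> \dim (<[x]> + <[y]>) = 2.
Proof.
move=> x0 yx; have y0 : y != 0 by apply: contraNneq yx => ->; rewrite mem0v.
rewrite dimv_disjoint_sum ?dim_vline ?x0 ?y0 //; apply/eqP/negPn/negP => I0.
case/negP: yx; have /memv_capP[Ix Iy] := memv_pick (<[x]> :&: <[y]>)%VS.
rewrite -vpick0 in I0; rewrite memvE -(vline_eq I0 Iy) -memvE.
exact: Ix.
Qed.

Definition indep3 x y z :=
  forall a b c, a *: x + b *: y + c *: z = 0 -> [/\ a = 0, b = 0 & c = 0].

Lemma indep3P x y z : x != 0 -> y \notin <[x]>%VS ->
  z \notin (<[x]> + <[y]>)%VS -> indep3 x y z.
Proof.
move=> x0 yx zxy a b c E.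
have c0 : c = 0.
  apply/eqP/negPn/negP => c0; case/negP: zxy; apply/mem_vlineD.
  exists (- a / c), (- b / c); apply: (scalerI c0).
  rewrite scalerDr !scalerA [c * _]mulrC [c * (- b / c)]mulrC !mulfVK //.
  by rewrite !scaleNr -opprD; apply/eqP; rewrite -addr_eq0 addrC E.
move: E; rewrite c0 scale0r addr0 => E.
have b0 : b = 0.
  apply/eqP/negPn/negP => b0; case/negP: yx; apply/vlineP.
  exists (- a / b); apply: (scalerI b0).
  rewrite scalerA mulrC mulfVK // scaleNr; apply/eqP.
  by rewrite -addr_eq0 addrC E.
move: E; rewrite b0 scale0r addr0 => /eqP.
by rewrite scaler_eq0 (negPf x0) orbF => /eqP.
Qed.

End VectorSpace.

Section Flats.
Variables (n : nat) (L : finFieldType).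
Implicit Types (x y : 'rV[L]_n.+1) (X U : PG n L).

Lemma vline_points x : (<[x]>%VS \in points) = (x != 0).
Proof. by rewrite inE dim_vline; case: (x == 0). Qed.

Lemma pointsP X : X \in points -> exists2 x, x != 0 & X = <[x]>%VS.
Proof.
rewrite inE => /eqP dX; have X0 : vpick X != 0 by rewrite vpick0 -dimv_eq0 dX.
exists (vpick X) => //; apply/esym/eqP.
by rewrite eqEdim -memvE memv_pick dX dim_vline X0.
Qed.

Lemma mem_points_of x U : x != 0 -> (<[x]>%VS \in points_of U) = (x \in U).
Proof. by move=> x0; rewrite inE vline_points x0 memvE. Qed.

Lemma line_eqD x y U : x != 0 -> y \notin <[x]>%VS -> U \in lines ->
  x \in U -> y \in U -> U = (<[x]> + <[y]>)%VS.
Proof.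
move=> x0 yx; rewrite inE => /eqP dU Ux Uy; apply/esym/eqP.
by rewrite eqEdim dim_vlineD // dU subv_add -!memvE Ux Uy.
Qed.

End Flats.

(** * Points and lines generated inside a subplane *)

Section Subplane.
Variables (K : finFieldType) (q : nat) (B M : {set PG 2 K}).
Hypothesis BM : subplane q B M.
Implicit Types (v w x y z : 'rV[K]_3).

Lemma subplane_points X : X \in B -> X \in points.
Proof. by case: BM => [[/subsetP sB _] _ _ _ _] /sB. Qed.

Lemma subplane_lines l : l \in M -> l \in lines.
Proof. by case: BM => [[_ /subsetP sM] _ _ _ _] /sM. Qed.

Lemma subplane_neq0 x : <[x]>%VS \in B -> x != 0.
Proof. by move/subplane_points; rewrite vline_points. Qed.

Lemma subplane_join x y : <[x]>%VS \in B -> <[y]>%VS \in B ->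
  y \notin <[x]>%VS -> (<[x]> + <[y]>)%VS \in M.
Proof.
move=> Bx By yx; have x0 := subplane_neq0 Bx.
case: BM => [_ joinB _ _ _].
have xy : <[x]>%VS != <[y]>%VS by apply: contraNneq yx => ->; apply: memv_line.
have [l Ml /andP[lx ly]] := joinB _ _ Bx By xy.
by rewrite -(line_eqD x0 yx (subplane_lines Ml)).
Qed.

(** In general both joins are subplane lines, distinct because [z] is off the first, so their common
    point is in [B]. If [x] and [y], or [z] and [w], span the same point, then [v] spans it too;
    callers therefore need no independence check. *)
Lemma subplane_meet x y z w v :
    <[x]>%VS \in B -> <[y]>%VS \in B -> <[z]>%VS \in B -> <[w]>%VS \in B ->
    v != 0 -> v \in (<[x]> + <[y]>)%VS -> v \in (<[z]> + <[w]>)%VS ->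
  z \notin (<[x]> + <[y]>)%VS -> <[v]>%VS \in B.
Proof.
move=> Bx By Bz Bw v0 xyv zwv zxy.
have [yx|yx] := boolP (y \in <[x]>%VS).
  move: xyv; rewrite (vline_eq _ yx) ?subplane_neq0 // addvv => xv.
  by rewrite (vline_eq v0 xv).
have [wz|wz] := boolP (w \in <[z]>%VS).
  move: zwv; rewrite (vline_eq _ wz) ?subplane_neq0 // addvv => zv.
  by rewrite (vline_eq v0 zv).
have Ml := subplane_join Bx By yx; have Mm := subplane_join Bz Bw wz.
have lm : (<[x]> + <[y]> != <[z]> + <[w]>)%VS.
  by apply: contraNneq zxy => ->; rewrite memvE addvSl.
case: BM => [_ _ meetB _ _]; have [X BX /andP[lX mX]] := meetB _ _ Ml Mm lm.
have /pointsP[u u0 defX] := subplane_points BX.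
move: BX lX mX; rewrite defX -!memvE => BX lu mu.
suff vu : v \in <[u]>%VS by rewrite (vline_eq v0 vu).
apply: contraNT lm => uv.
rewrite (line_eqD u0 uv (subplane_lines Ml) lu xyv).
by rewrite (line_eqD u0 uv (subplane_lines Mm) mu zwv).
Qed.

(** A subplane line has [q + 1 > 2] points; one that differs from [<[x]>] and [<[y]>] has both
    coefficients nonzero. *)
Lemma subplane_third x y : (1 < q)%N -> <[x]>%VS \in B -> <[y]>%VS \in B ->
  y \notin <[x]>%VS ->
  exists a b, [/\ a != 0, b != 0 & <[a *: x + b *: y]>%VS \in B].
Proof.
move=> q_gt1 Bx By yx; have Ml := subplane_join Bx By yx.
case: (BM) => [_ _ _ _ /(_ _ Ml) card_l].
set l := (_ + _)%VS in Ml card_l; set A := _ :&: _ in card_l.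
have : (0 < #|A :\ <[x]>%VS :\ <[y]>%VS|)%N.
  have := cardsD1 <[x]>%VS A; have := cardsD1 <[y]>%VS (A :\ <[x]>%VS).
  rewrite card_l; case: (_ \in _); case: (_ \in _); case: #|_ :\ _ :\ _| => //.
  - by move=> ->; case=> qE; rewrite qE in q_gt1.
  - by move=> ->; case=> qE; rewrite qE in q_gt1.
  - by move=> ->; case=> qE; rewrite qE in q_gt1.
  by move=> ->.
case/card_gt0P=> Z; rewrite !inE => /and4P[Zy Zx BZ /andP[_ lZ]].
have /pointsP[z z0 defZ] := subplane_points BZ.
move: lZ BZ Zy Zx; rewrite {}defZ -memvE => /mem_vlineD[a [b defz]] Bz Zy Zx.
exists a, b; split; last by rewrite -defz.
  apply: contraNneq Zy => a0; apply/eqP/vline_eq => //.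
  by rewrite defz a0 scale0r add0r memvZ ?memv_line.
apply: contraNneq Zx => b0; apply/eqP/vline_eq => //.
by rewrite defz b0 scale0r addr0 memvZ ?memv_line.
Qed.

(** Two points of the quadrangle complete [T] to a triangle. Two of its sides carry a third subplane
    point each, and rescaling the basis vectors normalises these to [b2 - b3] and [b2 + b1]. *)
Lemma subplane_frame T : (1 < q)%N -> T \in B -> exists b1 b2 b3,
  [/\ T = <[b1]>%VS /\ indep3 b1 b2 b3,
      <[b2]>%VS \in B, <[b3]>%VS \in B, <[b2 - b3]>%VS \in B
    & <[b2 + b1]>%VS \in B].
Proof.
move=> q_gt1 BT; have [x x0 defT] := pointsP (subplane_points BT).
case: (BM) => [_ _ _ [Q [sQB cardQ] arcQ] _].
have [Y QY YT] : exists2 Y, Y \in Q & Y != T.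
  have : (0 < #|Q :\ T|)%N.
    by have := cardsD1 T Q; rewrite cardQ; case: (_ \in _); case: #|_|.
  by case/card_gt0P=> Y; rewrite !inE => /andP[]; exists Y.
have BY := subsetP sQB Y QY; have [y y0 defY] := pointsP (subplane_points BY).
rewrite {}defY {}defT in BY BT YT *.
have yx : y \notin <[x]>%VS by apply: contra YT => /(vline_eq y0)->.
have [Z QZ Zxy] : exists2 Z, Z \in Q & ~~ (Z <= <[x]> + <[y]>)%VS.
  have l := subplane_lines (subplane_join BT BY yx).
  have : (0 < #|Q :\: points_of (<[x]> + <[y]>)|)%N.
    rewrite cardsD subn_gt0 cardQ; apply: leq_ltn_trans (arcQ _ l) _.
    by [].
  case/card_gt0P=> Z; rewrite !inE => /andP[nZ QZ]; exists Z => //.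
  apply: contra nZ => ->.
  by have := subplane_points (subsetP sQB _ QZ); rewrite inE => ->.
have BZ := subsetP sQB Z QZ; have [z z0 defZ] := pointsP (subplane_points BZ).
rewrite {}defZ -memvE in BZ Zxy.
have xyz := indep3P x0 yx Zxy.
have zy : z \notin <[y]>%VS.
  by apply: contra Zxy; rewrite !memvE => /subv_trans->; rewrite ?addvSr.
have [a [b [a0 b0 Byz]]] := subplane_third q_gt1 BY BZ zy.
have [c [d [c0 d0 Bxy]]] := subplane_third q_gt1 BT BY yx.
(* [b2 - b3] is [a *: y + b *: z], and the factor [a / d * c] makes [b2 + b1] equal to [a / d] times
   [c *: x + d *: y]. *)
exists ((a / d * c) *: x), (a *: y), (- b *: z).
rewrite !vlineZ ?oppr_eq0 ?mulf_neq0 ?invr_eq0 // BY BZ; split=> //.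
- split=> // k l m; rewrite !scalerA => /xyz[/eqP + /eqP + /eqP].
  by rewrite !mulf_eq0 oppr_eq0 invr_eq0 (negPf a0) (negPf b0) (negPf c0)
    (negPf d0) !orbF => /eqP-> /eqP-> /eqP->.
- by rewrite scaleNr opprK.
rewrite -(@vlineZ _ _ (d / a)) ?mulf_neq0 ?invr_eq0 //.
suff -> : (d / a) *: (a *: y + (a / d * c) *: x) = c *: x + d *: y by [].
by rewrite scalerDr !scalerA addrC; congr (_ *: _ + _ *: _); field; rewrite ?a0 ?d0.
Qed.

End Subplane.

(** * Coordinates of a subplane with respect to a frame *)

Section Frame.
Variables (K : finFieldType) (q : nat) (B M : {set PG 2 K}).
Hypothesis BM : subplane q B M.
Hypothesis q_gt1 : (1 < q)%N.
Variables b1 b2 b3 : 'rV[K]_3.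
Hypothesis b_indep : indep3 b1 b2 b3.
Hypotheses (Bb1 : <[b1]>%VS \in B) (Bb2 : <[b2]>%VS \in B).
Hypotheses (Bb3 : <[b3]>%VS \in B) (Bb23 : <[b2 - b3]>%VS \in B).
Hypothesis Bb12 : <[b2 + b1]>%VS \in B.
Implicit Types (x m n : K).

Local Ltac vec := apply/rowP => ?; rewrite !mxE; ring.

Let frame_neq0 a b c : (a != 0) || (b != 0) || (c != 0) ->
  a *: b1 + b *: b2 + c *: b3 != 0.
Proof. by apply: contraTneq => /b_indep[-> -> ->]; rewrite eqxx. Qed.

Let frame_inj a b c a' b' c' :
  a *: b1 + b *: b2 + c *: b3 = a' *: b1 + b' *: b2 + c' *: b3 ->
  [/\ a = a', b = b' & c = c'].
Proof.
move=> /eqP; rewrite -subr_eq0 => /eqP E.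
have /b_indep[/eqP + /eqP + /eqP] :
  (a - a') *: b1 + (b - b') *: b2 + (c - c') *: b3 = 0 by rewrite -[RHS]E; vec.
by rewrite !subr_eq0 => /eqP-> /eqP-> /eqP->.
Qed.

(** Affine coordinates of the subplane points on the line [b1 b2], with [<[b1]>] as its point at
    infinity. They turn out to form the subfield of order [q]. *)
Definition frame_coord := [set x | <[b2 + x *: b1]>%VS \in B].

Local Notation R := frame_coord.

Lemma frame_coord0 : 0 \in R.
Proof. by rewrite inE scale0r addr0. Qed.

Let b2_neq0 x : b2 + x *: b1 != 0.
Proof.
have -> : b2 + x *: b1 = x *: b1 + 1 *: b2 + 0 *: b3 by vec.
by apply: frame_neq0; rewrite oner_eq0 orbT.
Qed.

Let b3_neq0 x : b3 + x *: b1 != 0.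
Proof.
have -> : b3 + x *: b1 = x *: b1 + 0 *: b2 + 1 *: b3 by vec.
by apply: frame_neq0; rewrite oner_eq0 !orbT.
Qed.

(** Of the [q + 1] subplane points on the line [b1 b2], only [<[b1]>] has no coordinate. *)
Lemma card_frame_coord : #|R| = q.
Proof.
have b21 : b2 \notin <[b1]>%VS.
  apply/vlineP => -[k E].
  have /frame_inj[_ /eqP] :
    0 *: b1 + 1 *: b2 + 0 *: b3 = k *: b1 + 0 *: b2 + 0 *: b3.
    by transitivity b2; [vec | rewrite E; vec].
  by rewrite oner_eq0.
have Ml := subplane_join BM Bb1 Bb2 b21.
have [_ _ _ _ /(_ _ Ml) card_l] := BM.
set A := _ :&: _ in card_l.
have b10 := subplane_neq0 BM Bb1.
have defA : A = <[b1]>%VS |: [set <[b2 + x *: b1]>%VS | x in R].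
  apply/setP=> X; rewrite !in_setU1 in_setI; apply/andP/orP.
    case=> BX; have /pointsP[v v0 defX] := subplane_points BM BX.
    rewrite {X}defX in BX *.
    rewrite mem_points_of // => /mem_vlineD[a [b defv]].
    have [b0|b0] := eqVneq b 0.
      left; apply/eqP/vline_eq => //.
      by rewrite defv b0 scale0r addr0 memvZ ?memv_line.
    have Ev : <[v]>%VS = <[b2 + (a / b) *: b1]>%VS.
      rewrite -[RHS](vlineZ _ b0) defv; congr <[_]>%VS.
      by rewrite scalerDr scalerA mulrC mulfVK // addrC.
    by right; apply/imsetP; exists (a / b); rewrite ?inE -?Ev.
  case=> [/eqP->|/imsetP[x + ->]].
    by rewrite Bb1 mem_points_of // -{1}[b1]addr0 memv_add ?memv_line ?mem0v.
  rewrite inE => ->; rewrite mem_points_of //; split=> //.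
  by apply/mem_vlineD; exists x, 1; vec.
move: card_l; rewrite defA cardsU1 card_imset => [|x y E].
  suff -> : <[b1]>%VS \notin [set <[b2 + x *: b1]>%VS | x in R] by case.
  apply/imsetP => -[x _ E]; have := memv_line b1; rewrite E => /vlineP[k Ek].
  have /frame_inj[+ k0 _] : 1 *: b1 + 0 *: b2 + 0 *: b3 =
      (k * x) *: b1 + k *: b2 + 0 *: b3.
    by transitivity b1; [vec | rewrite {1}Ek; vec].
  by rewrite -k0 mul0r => /eqP; rewrite oner_eq0.
have := memv_line (b2 + x *: b1); rewrite E => /vlineP[k Ek].
have /frame_inj[-> <- _] : x *: b1 + 1 *: b2 + 0 *: b3 =
      (k * y) *: b1 + k *: b2 + 0 *: b3.
    by transitivity (b2 + x *: b1); [vec | rewrite Ek; vec].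
by rewrite mul1r.
Qed.

(* Projecting from [<[b2 - b3]>] onto the line [b1 b3]. *)
Lemma frame_coordE x : (x \in R) = (<[b3 + x *: b1]>%VS \in B).
Proof.
rewrite inE; apply/idP/idP => Bx.
  apply: (subplane_meet BM Bx Bb23 Bb1 Bb3) => //.
  - by apply/mem_vlineD; exists 1, (-1); vec.
  - by apply/mem_vlineD; exists x, 1; vec.
  apply/mem_vlineD => -[a [b E]].
  have /frame_inj[+ E1 E2] : 1 *: b1 + 0 *: b2 + 0 *: b3 =
      (a * x) *: b1 + (a + b) *: b2 + (- b) *: b3.
    by transitivity b1; [vec | rewrite {1}E; vec].
  move: E1; rewrite (_ : b = 0) ?addr0 => [<-|].
    by rewrite mul0r => /eqP; rewrite oner_eq0.
  by apply/eqP; rewrite -oppr_eq0 -E2.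
apply: (subplane_meet BM Bx Bb23 Bb1 Bb2) => //.
- by apply/mem_vlineD; exists 1, 1; vec.
- by apply/mem_vlineD; exists x, 1; vec.
apply/mem_vlineD => -[a [b E]].
have /frame_inj[+ E1 E2] : 1 *: b1 + 0 *: b2 + 0 *: b3 =
      (a * x) *: b1 + b *: b2 + (a - b) *: b3.
    by transitivity b1; [vec | rewrite {1}E; vec].
move: E2; rewrite -E1 subr0 => <-.
by rewrite mul0r => /eqP; rewrite oner_eq0.
Qed.

Lemma frame_coord1 : 1 \in R.
Proof. by rewrite inE scale1r. Qed.

(* The intersection of the line joining [<[b2 + x b1]>] and [<[b3 + b1]>] with
   the line [b2 b3]. *)
Lemma frame_coord_base x : x \in R -> <[b2 - x *: b3]>%VS \in B.
Proof.
rewrite inE => Bx; have := frame_coord1; rewrite frame_coordE => B1.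
have v0 : b2 - x *: b3 != 0.
  have -> : b2 - x *: b3 = 0 *: b1 + 1 *: b2 + (- x) *: b3 by vec.
  by apply: frame_neq0; rewrite oner_eq0 orbT.
apply: (subplane_meet BM Bx B1 Bb3 Bb2) => //.
- by apply/mem_vlineD; exists 1, (- x); vec.
- by apply/mem_vlineD; exists (- x), 1; vec.
apply/mem_vlineD => -[a [b E]].
have /frame_inj[+ E1 E2] : 0 *: b1 + 0 *: b2 + 1 *: b3 =
      (a * x + b) *: b1 + a *: b2 + b *: b3.
    by transitivity b3; [vec | rewrite {1}E; vec].
by rewrite -E1 -E2 mul0r add0r => /esym/eqP; rewrite oner_eq0.
Qed.

(* The intersection of the line joining [<[b2 - x b3]>] and [<[b3 + y b1]>]
   with the line [b1 b2]. *)
Lemma frame_coordM x y : x \in R -> y \in R -> x * y \in R.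
Proof.
move=> /frame_coord_base Bx; rewrite frame_coordE => By; rewrite inE.
apply: (subplane_meet BM Bx By Bb1 Bb2) => //.
- by apply/mem_vlineD; exists 1, x; vec.
- by apply/mem_vlineD; exists (x * y), 1; vec.
apply/mem_vlineD => -[a [b E]].
have /frame_inj[+ E1 E2] : 1 *: b1 + 0 *: b2 + 0 *: b3 =
      (b * y) *: b1 + a *: b2 + (b - a * x) *: b3.
    by transitivity b1; [vec | rewrite {1}E; vec].
move: E2; rewrite -E1 mul0r subr0 => <-.
by rewrite mul0r => /eqP; rewrite oner_eq0.
Qed.

(** The [q - 1] nonzero coordinates are closed under products, so their powers of exponent [q - 1]
    are 1. Hence the [q] coordinates are all the roots of [X^q - X]. *)
Lemma mem_frame_coord x : (x \in R) = (x ^+ q == x).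
Proof.
have q0 : (0 < q)%N := ltnW q_gt1.
have fixR y : y \in R -> y ^+ q = y.
  have [->|y0 Ry] := eqVneq y 0; first by rewrite expr0n; case: (q) q0.
  have Dy : y \in R :\ 0 by rewrite in_setD1 y0.
  rewrite -[RHS]mul1r -(@expf_card_closed K (R :\ 0) y) //.
  - have := cardsD1 0 R; rewrite frame_coord0 card_frame_coord add1n => ->.
    by rewrite exprSr.
  - by rewrite in_setD1 eqxx.
  move=> u v; rewrite !in_setD1 => /andP[u0 Ru] /andP[v0 Rv].
  by rewrite mulf_neq0 // frame_coordM.
apply/idP/eqP => [/fixR //|].
by apply: mem_expf_fixed => //; apply: card_frame_coord.
Qed.

End Frame.

(** [l] and the line [x y] share a subplane point; it is not [<[x]>], so its [y] coefficient can be
    scaled to 1. *)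
Lemma subplane_slope (K : finFieldType) (q : nat) (B M : {set PG 2 K})
    (l : PG 2 K) (x y : 'rV[K]_3) :
    subplane q B M -> l \in M -> <[x]>%VS \in B -> <[y]>%VS \in B ->
    y \notin <[x]>%VS -> x \notin l ->
  exists2 m, <[y + m *: x]>%VS \in B & y + m *: x \in l.
Proof.
move=> BM Ml Bx By yx lx; have Mxy := subplane_join BM Bx By yx.
case: (BM) => [_ _ meetB _ _].
have nl : l != (<[x]> + <[y]>)%VS.
  by apply: contraNneq lx => ->; rewrite memvE addvSl.
have [X BX /andP[]] := meetB _ _ Ml Mxy nl.
have /pointsP[v v0 defX] := subplane_points BM BX; rewrite {X}defX in BX *.
rewrite -!memvE => lv /mem_vlineD[a [b defv]].
have b0 : b != 0.
  apply: contraNneq lx => b0; rewrite b0 scale0r addr0 in defv.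
  have a0 : a != 0 by apply: contraNneq v0 => a0; rewrite defv a0 scale0r.
  by rewrite -(scalerK a0 x) -defv memvZ.
have Ev : y + (a / b) *: x = b^-1 *: v.
  by rewrite defv scalerDr !scalerA mulVf // scale1r addrC [_ * a]mulrC.
by exists (a / b); rewrite Ev; [rewrite vlineZ ?invr_eq0 | apply: memvZ].
Qed.

(** Take [e1 = b1], and let [e2 = b2 - t *: b3] span the point where [linf] meets the line [b2 b3];
    then [beta = t]. A subplane line off [T] meets the lines [b1 b2] and [b1 b3] at coordinates [m]
    and [n], which determine its point on [linf]. *)
Lemma tangent_splash_coord (K : finFieldType) (q : nat) (linf T : PG 2 K)
    (ST : {set PG 2 K}) :
    (1 < q)%N -> linf \in lines -> tangent_splash q linf T ST ->
  exists (e1 e2 : 'rV[K]_3) (beta : K),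
    [/\ e1 != 0 /\ e2 \notin <[e1]>%VS, linf = (<[e1]> + <[e2]>)%VS,
        T = <[e1]>%VS, beta ^+ q != beta
      & forall X, X \in ST <-> X = <[e1]>%VS \/
          exists m n : K, [/\ m ^+ q = m, n ^+ q = n
                        & X = <[(m - n * beta) *: e1 + e2]>%VS]].
Proof.
move=> q_gt1 lline [B [M [BM BT ->{ST}]]].
have /setIP[TB Tl] : T \in B :&: points_of linf by rewrite BT set11.
have onlyT (x : 'rV[K]_3) : <[x]>%VS \in B -> x \in linf -> <[x]>%VS = T.
  move=> Bx lx; apply/set1P; rewrite -BT in_setI Bx mem_points_of //.
  by have := subplane_neq0 BM Bx.
have [b1 [b2 [b3 [[defT ind] Bb2 Bb3 Bb23 Bb12]]]] := subplane_frame BM q_gt1 TB.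
have Bb1 : <[b1]>%VS \in B by rewrite -defT.
have Rq := mem_frame_coord BM q_gt1 ind Bb1 Bb2 Bb3 Bb23 Bb12.
have Rbase := @frame_coord_base _ _ _ _ BM _ _ _ ind Bb1 Bb2 Bb3 Bb23 Bb12.
have b10 := subplane_neq0 BM Bb1.
have vec a b c (v : 'rV[K]_3) : v = a *: b1 + b *: b2 + c *: b3 ->
    (b != 0) || (c != 0) -> v \notin <[b1]>%VS.
  move=> -> bc; apply/vlineP => -[k E].
  have /ind[_ b0 c0] : (a - k) *: b1 + b *: b2 + c *: b3 = 0.
    by rewrite -[RHS](subrr (k *: b1)) -{1}E; apply/rowP=> i; rewrite !mxE; ring.
  by rewrite b0 c0 eqxx in bc.
have b21 : b2 \notin <[b1]>%VS.
  by apply: (vec 0 1 0); rewrite ?oner_eq0 // !scale0r scale1r add0r addr0.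
have b31 : b3 \notin <[b1]>%VS.
  by apply: (vec 0 0 1); rewrite ?oner_eq0 ?orbT // !scale0r scale1r !add0r.
have onlyb1 (x : 'rV[K]_3) : <[x]>%VS \in B -> x \in linf -> x \in <[b1]>%VS.
  by move=> Bx lx; rewrite -defT -(onlyT x Bx lx) memv_line.
have lb1 : b1 \in linf by rewrite -(mem_points_of _ b10) -defT.
have b23 : b3 \notin <[b2]>%VS.
  apply/vlineP => -[k E]; have /ind[_ _ /eqP] :
    0 *: b1 + (- k) *: b2 + 1 *: b3 = 0.
    by rewrite E; apply/rowP=> i; rewrite !mxE; ring.
  by rewrite oner_eq0.
have [t lt] : exists t, b2 - t *: b3 \in linf.
  have I0 : vpick (linf :&: (<[b2]> + <[b3]>)) != 0.
    rewrite vpick0 -dimv_eq0 -lt0n.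
    have := dimvS (subvf (linf + (<[b2]> + <[b3]>))); rewrite dimvf /dim /= mul1n.
    have := dimv_sum_cap linf (<[b2]> + <[b3]>).
    rewrite dim_vlineD ?(subplane_neq0 BM Bb2) //.
    have := lline; rewrite inE => /eqP->.
    by case: (\dim (linf :&: _)) => [|//]; rewrite addn0 => ->.
  have /memv_capP[] := memv_pick (linf :&: (<[b2]> + <[b3]>)).
  move: (vpick _) I0 => v v0 lv /mem_vlineD[a [b defv]].
  (* Otherwise [<[b3]>] would be a second subplane point on [linf]. *)
  have a0 : a != 0.
    apply: contraNneq b31 => a0; rewrite a0 scale0r add0r in defv.
    have b0 : b != 0 by apply: contraNneq v0 => b0; rewrite defv b0 scale0r.
    by apply: onlyb1 => //; rewrite -(scalerK b0 b3) -defv memvZ.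
  exists (- (b / a)).
  suff -> : b2 - (- (b / a)) *: b3 = a^-1 *: v by apply: memvZ.
  by rewrite defv scalerDr !scalerA mulVf // scale1r scaleNr opprK [_ * b]mulrC.
have e2b1 : b2 - t *: b3 \notin <[b1]>%VS.
  apply: (vec 0 1 (- t)); rewrite ?oner_eq0 //.
  by rewrite scale0r scale1r add0r scaleNr.
have deflinf := line_eqD b10 e2b1 lline lb1 lt.
exists b1, (b2 - t *: b3), t; split=> // [|X].
  (* For [t] in the subfield, [<[b2 - t *: b3]>] would be a subplane point on [linf] other than
     [T]. *)
  by apply: contra e2b1; rewrite -Rq => /Rbase Be2; apply: onlyb1.
have slope m n : (m - n * t) *: b1 + (b2 - t *: b3) =
    1 *: (b2 + m *: b1) + (- t) *: (b3 + n *: b1).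
  by apply/rowP=> i; rewrite !mxE; ring.
have lslope m : m *: b1 + (b2 - t *: b3) \in linf by rewrite memvD ?memvZ.
have slope0 m : m *: b1 + (b2 - t *: b3) != 0.
  apply: contraNneq e2b1 => /eqP; rewrite addrC addr_eq0 => /eqP->.
  by rewrite memvN memvZ ?memv_line.
split; last first.
  case=> [->|[m [n [mq nq ->]]]].
    rewrite inE mem_points_of // lb1; apply/existsP.
    by exists (<[b1]> + <[b2]>)%VS; rewrite (subplane_join BM) // addvSl.
  rewrite inE mem_points_of // lslope; apply/existsP.
  exists (<[b2 + m *: b1]> + <[b3 + n *: b1]>)%VS; apply/andP; split.
    apply: (subplane_join BM).
    - by have := Rq m; rewrite inE mq eqxx.
    - rewrite -(frame_coordE BM ind Bb1 Bb2 Bb3 Bb23) //.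
      by rewrite Rq nq.
    apply/vlineP => -[k E].
    have /ind[_ _ /eqP] : (n - k * m) *: b1 + (- k) *: b2 + 1 *: b3 = 0.
      rewrite -[RHS](subrr (b3 + n *: b1)) {2}E.
      by apply/rowP=> i; rewrite !mxE; ring.
    by rewrite oner_eq0.
  by rewrite -memvE slope; apply/mem_vlineD; exists 1, (- t).
rewrite inE => /andP[lX /existsP[l /andP[Ml Xl]]].
have /pointsP[x x0 defX] : X \in points by move: lX; rewrite inE => /andP[].
rewrite {X}defX mem_points_of // -memvE in lX Xl *.
(* [linf] carries one subplane point, a subplane line carries [q + 1]. *)
have nl : l != linf.
  apply: contraTneq q_gt1 => E; case: (BM) => [_ _ _ _ /(_ _ Ml)].
  by rewrite E BT cards1 => -[<-].
have [lb|lb] := boolP (b1 \in l).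
  left; apply: vline_eq => //; apply: contraNT nl => xb1.
  rewrite (line_eqD b10 xb1 (subplane_lines BM Ml) lb Xl).
  by rewrite (line_eqD b10 xb1 lline lb1 lX).
have [m Bm lm] := subplane_slope BM Ml Bb1 Bb2 b21 lb.
have [n Bn ln] := subplane_slope BM Ml Bb1 Bb3 b31 lb.
right; exists m, n; split.
- by apply/eqP; rewrite -Rq inE.
- by apply/eqP; rewrite -Rq (frame_coordE BM ind Bb1 Bb2 Bb3 Bb23).
(* [x] and this vector lie on both [l] and [linf]; as these lines differ, the two vectors are
   proportional. *)
apply: vline_eq => //; apply: contraNT nl => xv.
have lv : (m - n * t) *: b1 + (b2 - t *: b3) \in l.
  by rewrite slope memvD ?memvZ.
rewrite (line_eqD (slope0 _) xv (subplane_lines BM Ml) lv Xl).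
by rewrite (line_eqD (slope0 _) xv lline (lslope _) lX).
Qed.

(** * Coordinates of the Bruck-Bose representation *)

Section AffineChart.
Variables (n : nat) (L : finFieldType) (H : PG n L) (w : 'rV[L]_n.+1).
Hypotheses (dimH : \dim H = n) (Hw : w \notin H).

Lemma affine_chart_mem y : y \in H -> w + y \notin H.
Proof. by move=> Hy; rewrite rpredDr. Qed.

Lemma affine_chart_neq0 y : y \in H -> w + y != 0.
Proof. by move=> /affine_chart_mem; apply: contraNneq => ->; apply: mem0v. Qed.

Lemma affine_chart_points y : y \in H ->
  <[w + y]>%VS \in points :\: points_of H.
Proof.
move=> Hy; have w0 := affine_chart_neq0 Hy.
by rewrite in_setD mem_points_of // affine_chart_mem // vline_points.
Qed.

(** [w + y = k *: (w + z)] puts [(k - 1) *: w] in [H], hence [k = 1]. *)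
Lemma affine_chart_inj y z : y \in H -> z \in H ->
  <[w + y]>%VS = <[w + z]>%VS -> y = z.
Proof.
move=> Hy Hz E; have := memv_line (w + y); rewrite E => /vlineP[k Ek].
have : (k - 1) *: w \in H.
  have -> : (k - 1) *: w = y - k *: z.
    apply/eqP; rewrite scalerBl scale1r subr_eq addrAC eq_sym subr_eq addrC Ek.
    by rewrite scalerDr.
  by rewrite memvB ?memvZ.
have [k1 _|k1 Hk] := eqVneq (k - 1) 0.
  by move/eqP: k1 Ek; rewrite subr_eq0 => /eqP->; rewrite scale1r => /addrI.
by case/negP: Hw; rewrite -(scalerK k1 w) memvZ.
Qed.

(** [w] and the hyperplane [H] span the space, and outside [H] the coefficient of [w] can be scaled
    to 1. *)
Lemma affine_chart_surj X : X \in points :\: points_of H ->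
  exists2 y, y \in H & X = <[w + y]>%VS.
Proof.
rewrite in_setD => /andP[Hx /pointsP[x x0 E]].
rewrite {X}E mem_points_of // in Hx *.
have full : (<[w]> + H = fullv)%VS.
  have w0 : w != 0 by apply: contraNneq Hw => ->; apply: mem0v.
  apply/eqP; rewrite eqEdim subvf dimvf /dim /= mul1n.
  rewrite dimv_disjoint_sum ?dim_vline ?w0 ?dimH //.
  apply/eqP; rewrite -subv0; apply/subvP => v /memv_capP[/vlineP[k ->] Hk].
  have [->|k0] := eqVneq k 0; first by rewrite scale0r mem0v.
  by case/negP: Hw; rewrite -(scalerK k0 w) memvZ.
have := memvf x; rewrite -full => /memv_addP[_ /vlineP[k ->] [y Hy Ex]].
have k0 : k != 0 by apply: contraNneq Hx => k0; rewrite Ex k0 scale0r add0r.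
exists (k^-1 *: y); first exact: memvZ.
by rewrite -[RHS](vlineZ _ k0) scalerDr scalerA mulfV // scale1r -Ex.
Qed.

End AffineChart.

(** * The Bruck-Bose map in vector coordinates *)

Section BruckBose.
Variables (F K : finFieldType) (linf : PG 2 K) (Sigma : PG 6 F).
Variables (S : {set PG 6 F}) (bb : PG 2 K -> PG 6 F).
Hypothesis bbP : bruck_bose linf Sigma S bb.

Lemma bb_infinity_mem x : x \in linf -> x != 0 -> bb <[x]>%VS \in S.
Proof.
move=> lx x0; have [_ <-] := bb_infinity bbP.
by rewrite imset_f // mem_points_of.
Qed.

Lemma spread_mem P : P \in S -> \dim P = 3 /\ (P <= Sigma)%VS.
Proof.
have [[/subsetP sS _ _] _] := bb_spread bbP.
by move/sS; rewrite inE => /andP[+ ->]; rewrite inE => /eqP.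
Qed.

Lemma spread_eq P Q x : P \in S -> Q \in S -> x != 0 -> x \in P -> x \in Q ->
  P = Q.
Proof.
move=> SP SQ x0 Px Qx; have [[_ _ partS] _] := bb_spread bbP.
have [_ sP] := spread_mem SP.
have /partS[R [_ uniqR]] : <[x]>%VS \in points_of Sigma.
  by rewrite mem_points_of // (subvP sP).
by rewrite -(uniqR P) ?(uniqR Q).
Qed.

(** Distinct spread planes share only the zero vector, and [bb] is injective on the points of
    [linf]. *)
Lemma bb_infinity_inj x y z : x \in linf -> y \in linf -> x != 0 -> y != 0 ->
  z != 0 -> z \in bb <[x]>%VS -> z \in bb <[y]>%VS -> <[x]>%VS = <[y]>%VS.
Proof.
move=> lx ly x0 y0 z0 xz yz; have [inj _] := bb_infinity bbP.
apply: inj; rewrite ?mem_points_of //.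
by apply: (spread_eq _ _ z0); rewrite ?bb_infinity_mem.
Qed.

(** With origins [v0] and [w0], the chart is defined by [bb <[v0 + x]> = <[w0 + f x]>]. The points
    of [v0 + x] and [v0 + x + e] lie on a line through [<[e]>], and the solid of that line meets
    [Sigma] in the spread plane of [<[e]>]. *)
Lemma bruck_bose_chart : exists f : 'rV[K]_3 -> 'rV[F]_7,
  [/\ f 0 = 0, {in linf &, injective f}, {in linf, forall x, f x \in Sigma},
      {in Sigma, forall y, exists2 x, x \in linf & f x = y}
    & {in linf &, forall x e, e != 0 -> f (x + e) - f x \in bb <[e]>%VS}].
Proof.
have diml : \dim linf = 2 by have := bb_linf bbP; rewrite inE => /eqP.
have dimS : \dim Sigma = 6 by have := bb_Sigma bbP; rewrite inE => /eqP.
have [v0 lv0] : exists v0, v0 \notin linf.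
  have /subvPn[v _ lv] : ~~ (fullv <= linf)%VS; last by exists v.
  by apply: contraL isT => /dimvS; rewrite dimvf diml.
have [injA imA] := bb_affine bbP.
have affA x : x \in linf -> bb <[v0 + x]>%VS \in points :\: points_of Sigma.
  by move=> lx; rewrite -imA imset_f // affine_chart_points.
have l0 : 0 \in linf := mem0v _; have S0 : 0 \in Sigma := mem0v _.
have := affA 0 l0; rewrite in_setD => /andP[+ /pointsP[w0 w00 Ew0]].
rewrite Ew0 mem_points_of // => Sw0.
(* For [x] in [linf] such a [y] exists, so the default 0 only occurs elsewhere. *)
pose f x := odflt 0
  [pick y | (y \in Sigma) && (bb <[v0 + x]>%VS == <[w0 + y]>%VS)].
have fP x : x \in linf -> f x \in Sigma /\ bb <[v0 + x]>%VS = <[w0 + f x]>%VS.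
  move=> lx; rewrite /f; case: pickP => [y /andP[Sy /eqP] //|noy].
  have [y Sy Ey] := affine_chart_surj dimS Sw0 (affA x lx).
  by have := noy y; rewrite Sy Ey eqxx.
have fE x y : x \in linf -> y \in Sigma -> bb <[v0 + x]>%VS = <[w0 + y]>%VS ->
    f x = y.
  move=> lx Sy E; have [Sf Ef] := fP x lx.
  by apply: (affine_chart_inj Sw0) => //; rewrite -Ef.
exists f; split.
- by apply: fE; rewrite ?Ew0 ?addr0.
- move=> x y lx ly Exy; have [_ Ex] := fP x lx; have [_ Ey] := fP y ly.
  apply: (affine_chart_inj lv0) => //.
  by apply: injA; rewrite ?affine_chart_points // Ex Ey Exy.
- by move=> x /fP[].
- move=> y Sy; have := affine_chart_points Sw0 Sy; rewrite -imA.
  case/imsetP => X /(affine_chart_surj diml lv0)[x lx ->] E.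
  by exists x => //; apply: fE; rewrite -?E.
move=> x e lx le e0; pose l := (<[v0 + x]> + <[e]>)%VS.
have evx : e \notin <[v0 + x]>%VS.
  apply/vlineP => -[k Ee]; have := affine_chart_mem lv0 lx.
  have k0 : k != 0 by apply: contraNneq e0 => k0; rewrite Ee k0 scale0r.
  by rewrite -(scalerK k0 (v0 + x)) -Ee memvZ.
have vx0 := affine_chart_neq0 lv0 lx.
have ll : l \in lines :\ linf.
  rewrite in_setD1 inE dim_vlineD // eqxx andbT.
  apply: contraNneq (affine_chart_mem lv0 lx) => <-.
  by rewrite memvE addvSl.
have inW X : X \in points -> (X <= l)%VS -> (bb X <= bb l)%VS.
  by move=> pX; rewrite (bb_incidence bbP pX ll).
have [_ imL] := bb_lines bbP.
have := imset_f bb ll; rewrite imL !inE => /and3P[/eqP dimW SW _].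
set W := bb l in dimW SW inW.
have Se := bb_infinity_mem le e0; have [dime sub_e] := spread_mem Se.
(* [W] has vector dimension 4 and is not inside [Sigma], so the intersection has dimension at most
   3, which is that of the spread plane it contains. *)
have defe : bb <[e]>%VS = (W :&: Sigma)%VS.
  apply/eqP; rewrite eqEdim subv_cap sub_e inW ?vline_points ?addvSr // dime.
  rewrite -ltnS; apply: (@leq_trans (\dim W)); last by rewrite dimW.
  rewrite ltn_neqAle dimvS ?capvSl // andbT.
  apply: contra SW => /eqP E; have : (W :&: Sigma)%VS == W.
    by rewrite eqEdim capvSl E leqnn.
  by move/eqP <-; apply: capvSr.
have lxe : x + e \in linf by rewrite memvD.
have [Sx Ex] := fP x lx; have [Sxe Exe] := fP _ lxe.
rewrite defe; apply/memv_capP; split; last by rewrite memvB.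
have -> : f (x + e) - f x = (w0 + f (x + e)) - (w0 + f x).
  by rewrite opprD addrACA subrr add0r.
apply: memvB; rewrite memvE.
  rewrite -Exe inW ?vline_points ?(affine_chart_neq0 lv0) //.
  by rewrite -memvE addrA memv_add ?memv_line.
by rewrite -Ex inW ?vline_points // addvSl.
Qed.

Lemma dim_linf_outside x : exists2 y, y \in linf & y \notin <[x]>%VS.
Proof.
have := bb_linf bbP; rewrite inE => /eqP diml.
have /subvPn[y ly xy] : ~~ (linf <= <[x]>)%VS; last by exists y.
by apply: contraL isT => /dimvS; rewrite diml dim_vline; case: (x == 0).
Qed.

(* Additivity of the chart on independent vectors comes from the parallelogram
   with sides [x] and [y]; dependent vectors are reduced to that case by
   adding a vector off their line. *)
Lemma bruck_bose_additive : exists f : 'rV[K]_3 -> 'rV[F]_7,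
  [/\ {in linf &, forall x y, f (x + y) = f x + f y},
      {in linf &, injective f}, {in linf, forall x, f x \in Sigma}
    & {in linf, forall x, x != 0 ->
         forall y, y \in bb <[x]>%VS <-> exists k, y = f (k *: x)}].
Proof.
have [f [f0 injf fS surjf fl]] := bruck_bose_chart.
have fx x : x \in linf -> x != 0 -> f x \in bb <[x]>%VS.
  by move=> lx x0; have := fl 0 x (mem0v _) lx x0; rewrite add0r f0 subr0.
have fD x y : x \in linf -> y \in linf -> y \notin <[x]>%VS -> x != 0 ->
    f (x + y) = f x + f y.
  move=> lx ly yx x0; have y0 : y != 0 by apply: contraNneq yx => ->; rewrite mem0v.
  apply/eqP/negPn/negP; rewrite -subr_eq0 => d0.
  (* The defect of additivity lies in the spread planes of both [<[x]>] and [<[y]>]. *)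
  suff E : <[y]>%VS = <[x]>%VS by rewrite -E memv_line in yx.
  apply: (bb_infinity_inj ly lx y0 x0 d0).
    by rewrite opprD addrA memvB ?fx // fl.
  by rewrite opprD [- f x + _]addrC addrA memvB ?fx // [x + y]addrC fl.
have fD' x y : x \in linf -> y \in linf -> f (x + y) = f x + f y.
  move=> lx ly; have [->|x0] := eqVneq x 0; first by rewrite f0 !add0r.
  have [->|y0] := eqVneq y 0; first by rewrite f0 !addr0.
  have [xy|] := boolP (y \in <[x]>%VS); last by move=> yx; apply: fD.
  have [z lz zx] := dim_linf_outside x.
  have zxy : z \notin <[x + y]>%VS.
    by apply: contra zx; apply/subvP; rewrite -memvE memvD ?memv_line.
  have zy : z \notin <[y]>%VS by rewrite (vline_eq y0 xy).
  have E : f (x + y + z) = f (x + y) + f z.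
    have [->|xy0] := eqVneq (x + y) 0; first by rewrite f0 !add0r.
    by rewrite fD // memvD.
  apply: (addIr (f z)); rewrite -E -!addrA -(fD y) // -fD ?(memvD ly lz) //.
  by apply: contra zx => xyz;
    rewrite (_ : z = y + z - y) ?memvB // addrAC subrr add0r.
exists f; split=> // x lx x0 y; split=> [xy|[k ->]]; last first.
  have [->|k0] := eqVneq k 0; first by rewrite scale0r f0 mem0v.
  by rewrite -(vlineZ x k0) fx ?memvZ // scaler_eq0 negb_or k0.
have [_ sx] := spread_mem (bb_infinity_mem lx x0).
have [z lz defy] := surjf y (subvP sx y xy).
have [z0|z0] := eqVneq z 0; first by exists 0; rewrite scale0r -defy z0.
suff /vlineP[k E] : z \in <[x]>%VS by exists k; rewrite -defy E.
suff <- : <[z]>%VS = <[x]>%VS by apply: memv_line.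
apply: (bb_infinity_inj (z := y)) => //; last by rewrite -defy fx.
apply: contraNneq z0 => y0; apply/eqP/injf; rewrite ?mem0v // f0.
by rewrite defy.
Qed.

End BruckBose.

(** A scalar [c] maps every spread plane into itself, so it multiplies the coordinates of each
    vector by some element of [K]. Additivity forces the same element everywhere, and this is
    [phi c]. *)
Lemma bruck_bose_coord (F K : finFieldType) (linf : PG 2 K) (Sigma : PG 6 F)
    (S : {set PG 6 F}) (bb : PG 2 K -> PG 6 F) (e1 e2 : 'rV[K]_3) :
    bruck_bose linf Sigma S bb ->
    e1 != 0 -> e2 \notin <[e1]>%VS -> linf = (<[e1]> + <[e2]>)%VS ->
  exists (g : K -> K -> 'rV[F]_7) (phi : {rmorphism F -> K}),
    [/\ forall a b a' b', g (a + a') (b + b') = g a b + g a' b',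
        forall a b, g a b = 0 -> a = 0 /\ b = 0,
        forall c a b, g (phi c * a) (phi c * b) = c *: g a b,
        forall a b, g a b \in Sigma
      & forall a b, (a != 0) || (b != 0) -> forall y,
          y \in bb <[a *: e1 + b *: e2]>%VS <->
          exists k, y = g (k * a) (k * b)].
Proof.
move=> bbP e10 e21 deflinf.
have [f [fD injf fS bbf]] := bruck_bose_additive bbP.
pose v a b := a *: e1 + b *: e2; pose g a b := f (v a b).
have lv a b : v a b \in linf by rewrite deflinf; apply/mem_vlineD; exists a, b.
have vD a b a' b' : v (a + a') (b + b') = v a b + v a' b'.
  by rewrite /v !scalerDl addrACA.
have vZ k a b : v (k * a) (k * b) = k *: v a b by rewrite /v scalerDr !scalerA.
have v0 a b : v a b = 0 -> a = 0 /\ b = 0.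
  move=> E; have b0 : b = 0.
    apply/eqP/negPn/negP => b0; case/negP: e21.
    rewrite -(scalerK b0 e2) memvZ // -[b *: e2](addKr (a *: e1)) -/(v a b) E.
    by rewrite addr0 memvN memvZ ?memv_line.
  by move/eqP: E; rewrite /v b0 scale0r addr0 scaler_eq0 (negPf e10) orbF => /eqP.
have vI a b a' b' : v a b = v a' b' -> a = a' /\ b = b'.
  move=> E; have [] : a - a' = 0 /\ b - b' = 0.
    by apply: v0; rewrite vD -[- a']mulN1r -[- b']mulN1r vZ scaleN1r E subrr.
  by move=> /eqP + /eqP; rewrite !subr_eq0 => /eqP-> /eqP->.
have gD a b a' b' : g (a + a') (b + b') = g a b + g a' b'.
  by rewrite /g vD fD.
have gI a b a' b' : g a b = g a' b' -> a = a' /\ b = b'.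
  by move=> E; apply/vI/injf.
have f0 : f 0 = 0 by apply: (addrI (f 0)); rewrite -fD ?mem0v // !addr0.
have g00 : g 0 0 = 0 by rewrite /g /v !scale0r addr0.
have gN a b : g (- a) (- b) = - g a b.
  by apply: (addrI (g a b)); rewrite -gD !subrr g00.
have bbg a b : (a != 0) || (b != 0) -> forall y,
    y \in bb <[v a b]>%VS <-> exists k, y = g (k * a) (k * b).
  move=> ab y; have nz : v a b != 0.
    by apply: contraTneq ab => /v0[-> ->]; rewrite eqxx.
  split=> [/(bbf _ (lv a b) nz)[k ->]|[k ->]]; first by exists k; rewrite /g vZ.
  by apply/(bbf _ (lv a b) nz); exists k; rewrite /g vZ.
have scale c a b : exists k, c *: g a b = g (k * a) (k * b).
  have [|] := boolP ((a != 0) || (b != 0)); last first.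
    rewrite negb_or !negbK => /andP[/eqP-> /eqP->].
    by exists 0; rewrite !mulr0 g00 scaler0.
  move=> ab; apply/(bbg a b ab)/memvZ/(bbg a b ab).
  by exists 1; rewrite !mul1r.
have gsplit a b : g a b = g a 0 + g 0 b by rewrite -gD addr0 add0r.
(* The factor [k] found at [g 0 1] passes to [g a 0] by comparison at [g a 1], and then to [g 0 b]
   by comparison at [g 1 b]. *)
have common c : exists k, forall a b, g (k * a) (k * b) = c *: g a b.
  have [k Ek] := scale c 0 1; rewrite mulr0 mulr1 in Ek; exists k.
  have Hl a : c *: g a 0 = g (k * a) 0.
    have [l El] := scale c a 0; have [m Em] := scale c a 1.
    rewrite mulr0 mulr1 in El Em; move: Em.
    by rewrite gsplit scalerDr Ek El -gsplit => /gI[-> ->].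
  move=> a b; rewrite [in RHS]gsplit scalerDr Hl gsplit; congr (_ + _).
  have [l El] := scale c 0 b; have [m Em] := scale c 1 b.
  rewrite mulr0 mulr1 in El Em; move: Em.
  by rewrite gsplit scalerDr Hl El -gsplit mulr1 => /gI[<- ->].
have [phi phiP] := fin_all_exists common.
(* This uniqueness turns the laws of scalar multiplication into the morphism laws of [phi]. *)
have phi_uniq c x : (forall a b, g (x * a) (x * b) = c *: g a b) -> x = phi c.
  by move=> /(_ 1 0); rewrite -phiP !mulr1 => /gI[].
have phiB : zmod_morphism phi.
  move=> c d; apply/esym/phi_uniq => a b.
  by rewrite !mulrBl scalerBl -!phiP gD gN.
have phiM : monoid_morphism phi.
  split=> [|c d]; first by apply/esym/phi_uniq => a b; rewrite !mul1r scale1r.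
  by apply/esym/phi_uniq => a b; rewrite -!mulrA !phiP scalerA.
pose phi' : {rmorphism F -> K} := HB.pack phi
  (GRing.isZmodMorphism.Build F K phi phiB)
  (GRing.isMonoidMorphism.Build F K phi phiM).
exists g, phi'; split=> // [a b E|a b]; last exact: fS.
by apply: gI; rewrite E g00.
Qed.

(** * Cover planes *)

Lemma dim_addv_line (L : fieldType) (V : vectType L) (U : {vspace V}) v :
  v \notin U -> \dim (U + <[v]>) = (\dim U).+1.
Proof.
move=> Uv; have v0 : v != 0 by apply: contraNneq Uv => ->; apply: mem0v.
rewrite dimv_disjoint_sum ?dim_vline ?v0 ?addn1 //.
apply/eqP; rewrite -subv0; apply/subvP => w /memv_capP[Uw /vlineP[k Ew]].
have [k0|k0] := eqVneq k 0; first by rewrite Ew k0 scale0r mem0v.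
by case/negP: Uv; rewrite -(scalerK k0 v) -Ew memvZ.
Qed.

Section Vlines3.
Variables (L : fieldType) (V : vectType L).
Implicit Types x y z v : V.

Lemma mem_vlineD3 x y z v :
  v \in (<[x]> + <[y]> + <[z]>)%VS <->
  exists a b c, v = a *: x + b *: y + c *: z.
Proof.
split=> [/memv_addP[_ /mem_vlineD[a [b ->]] [_ /vlineP[c ->] ->]]|].
  by exists a, b, c.
move=> [a [b [c ->]]]; rewrite memv_add ?memvZ ?memv_line //.
by apply/mem_vlineD; exists a, b.
Qed.

Lemma dim_vlineD3 x y z : indep3 x y z -> \dim (<[x]> + <[y]> + <[z]>) = 3.
Proof.
move=> ind; have x0 : x != 0.
  apply/eqP => x0; have [] := ind 1 0 0.
    by rewrite x0 scaler0 !scale0r !addr0.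
  by move/eqP; rewrite oner_eq0.
rewrite dim_addv_line ?dim_vlineD //.
  apply/vlineP => -[k E]; have [] := ind (- k) 1 0.
    by rewrite E scale1r scaleNr addNr scale0r addr0.
  by move=> _ /eqP; rewrite oner_eq0.
apply/mem_vlineD => -[k [l E]]; have [] := ind (- k) (- l) 1.
  by rewrite E scale1r !scaleNr -opprD addNr.
by move=> _ _ /eqP; rewrite oner_eq0.
Qed.

End Vlines3.

(* At most two large fibres would cover at most [2 * n + (n - 1) < n ^ 2]
   elements. *)
Lemma three_large_fibres (I O J : finType) (n : nat) (r : I -> O * J) :
    injective r -> #|I| = (n ^ 2)%N -> #|O| = n.+1 -> #|J| = n -> (2 < n)%N ->
  exists o1 o2 o3, [/\ o1 != o2, o2 != o3 & o3 != o1] /\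
    {in [:: o1; o2; o3], forall o,
       exists i j, [/\ i != j, (r i).1 = o & (r j).1 = o]}.
Proof.
move=> injr cardI cardO cardJ n_gt2.
pose fibre o := [set i | (r i).1 == o]; pose big := [set o | (1 < #|fibre o|)%N].
suff /card_gt2P[o1 [o2 [o3 [[b1 b2 b3] neq]]]] : (2 < #|big|)%N.
  exists o1, o2, o3; split=> // o oin; have : o \in big.
    by move: oin; rewrite !in_cons in_nil orbF => /or3P[] /eqP->.
  rewrite inE => /card_gt1P[i [j [+ + ij]]].
  by rewrite !inE => /eqP Ei /eqP Ej; exists i, j.
have fibre_le o : (#|fibre o| <= n)%N.
  have injs : {in fibre o &, injective (fun i => (r i).2)}.
    move=> i j; rewrite !inE => /eqP Ei /eqP Ej E; apply: injr.
    by rewrite [r i]surjective_pairing [r j]surjective_pairing Ei Ej E.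
  by rewrite -(card_in_imset injs) -cardJ max_card.
have sum : (n ^ 2 = \sum_o #|fibre o|)%N.
  rewrite -cardI -sum1_card (partition_big (fun i => (r i).1) predT) //=.
  by apply: eq_bigr => o _; rewrite -sum1_card; apply: eq_bigl => i; rewrite inE.
(* Large fibres have at most [n] elements, since the second component of [r] is injective on a
   fibre; the other fibres have at most one. *)
have : (n ^ 2 <= #|big| * n + #|~: big|)%N.
  rewrite sum (bigID (mem big)) /= leq_add //.
    by rewrite -sum_nat_const; apply: leq_sum.
  rewrite -sum1_card (eq_bigl (fun o => o \notin big) _ (fun o => in_setC o big)).
  by apply: leq_sum => o; rewrite !inE -leqNgt.
have := cardsC big; rewrite cardO; move: #|big| #|~: big| => a b.
by move=> E; case: leqP => // a2 H; exfalso; nia.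
Qed.

(** * The explicit family of cover planes *)

Section Covers.
Variables (F K : finFieldType) (phi : {rmorphism F -> K}).
Hypothesis cardK : #|K| = (#|F| ^ 3)%N.
Variables (V : vectType F) (g : K -> K -> V) (beta : K).
Hypothesis gD : forall a b a' b', g (a + a') (b + b') = g a b + g a' b'.
Hypothesis g_eq0 : forall a b, g a b = 0 -> a = 0 /\ b = 0.
Hypothesis gZ : forall c a b, g (phi c * a) (phi c * b) = c *: g a b.
Hypothesis beta_notin : beta \notin codom phi.

(** These values fill the span of 1 and [beta] over [F]; the sign matches the parametrisation of the
    splash. *)
Let slope c d : K := phi c - phi d * beta.

Definition cover_plane k : {vspace V} :=
  (<[g k 0%R]> + <[(g (k * beta) 0)%R]> + <[g 0%R k]>)%VS.

Lemma rmorph_indep (s t : K) a b : s != 0 -> t / s \notin codom phi ->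
  phi a * s + phi b * t = 0 -> a = 0 /\ b = 0.
Proof.
move=> s0 ts E; have b0 : b = 0.
  apply/eqP/negPn/negP => b0; case/negP: ts; apply/codomP; exists (- a / b).
  have pb : phi b != 0 by rewrite fmorph_eq0.
  have /(mulfI pb)-> : phi b * t = phi b * (- phi a * s / phi b).
    by rewrite [RHS]mulrC divfK // mulNr; apply/eqP; rewrite -addr_eq0 addrC E.
  by rewrite rmorphM rmorphN fmorphV; field; rewrite s0 pb.
move: E; rewrite b0 rmorph0 mul0r addr0 => /eqP.
by rewrite mulf_eq0 fmorph_eq0 (negPf s0) orbF => /eqP->.
Qed.

Lemma slope_eq0 c d : slope c d = 0 -> c = 0 /\ d = 0.
Proof.
move=> E; have := @rmorph_indep 1 beta c (- d) (oner_neq0 _).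
rewrite divr1 mulr1 rmorphN mulNr => /(_ beta_notin E)[-> /eqP].
by rewrite oppr_eq0 => /eqP.
Qed.

Lemma coord_map0 : g 0 0 = 0.
Proof. by apply: (addrI (g 0 0)); rewrite -gD !addr0. Qed.

Lemma coord_mapN a b : g (- a) (- b) = - g a b.
Proof. by apply: (addrI (g a b)); rewrite -gD !subrr coord_map0. Qed.

Lemma coord_map_inj a b a' b' : g a b = g a' b' -> a = a' /\ b = b'.
Proof.
move=> E; have [] : a - a' = 0 /\ b - b' = 0.
  by apply: g_eq0; rewrite gD coord_mapN E subrr.
by move=> /eqP + /eqP; rewrite !subr_eq0 => /eqP-> /eqP->.
Qed.

Lemma coord_map_comb c d a k :
  c *: g k 0 + d *: g (k * beta) 0 + a *: g 0 k =
  g (k * (phi c + phi d * beta)) (k * phi a).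
Proof.
rewrite -!gZ -!gD; congr (g _ _); ring.
Qed.

Lemma mem_cover_plane k y : y \in cover_plane k <->
  exists c d a, y = g (k * slope c d) (k * phi a).
Proof.
split=> [/mem_vlineD3[c [d [a ->]]]|[c [d [a ->]]]].
  by exists c, (- d), a; rewrite coord_map_comb /slope rmorphN mulNr opprK.
by apply/mem_vlineD3; exists c, (- d), a; rewrite coord_map_comb rmorphN mulNr.
Qed.

Lemma dim_cover_plane k : k != 0 -> \dim (cover_plane k) = 3.
Proof.
move=> k0; apply: dim_vlineD3 => c d a.
rewrite coord_map_comb => /g_eq0[/eqP + /eqP].
rewrite !mulf_eq0 (negPf k0) /= fmorph_eq0 => /eqP + /eqP->.
rewrite -[d]opprK rmorphN mulNr => /slope_eq0[-> /eqP].
by rewrite oppr_eq0 => /eqP->; rewrite !oppr0.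
Qed.

Lemma cover_planeZ c k : c != 0 -> cover_plane (phi c * k) = cover_plane k.
Proof.
move=> c0; rewrite /cover_plane -mulrA -{1 2 3}[0](mulr0 (phi c)) !gZ.
by rewrite !vlineZ.
Qed.

(** Write [k = l * u] and [k * beta = l * v] with [u] and [v] in the span of 1 and [beta]. Then
    [u * beta = v] is a quadratic equation for [beta], which forces [u] into the image of [phi]. The
    two vectors span the trace of the cover plane of [k] on [T], so a cover plane is determined by
    its trace. *)
Lemma cover_plane_proportional k l : k != 0 -> l != 0 ->
  g k 0 \in cover_plane l -> g (k * beta) 0 \in cover_plane l ->
  exists2 c, c != 0 & k = phi c * l.
Proof.
move=> k0 l0 /mem_cover_plane[c [d [a /coord_map_inj[Ek _]]]].
move=> /mem_cover_plane[c' [d' [a' /coord_map_inj[Eb _]]]].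
have [d0 _ _] : [/\ - d = 0, c + d' = 0 & - c' = 0].
  apply: (quadratic_rmorph_eq0 cardK beta_notin).
  apply: (mulfI l0); rewrite mulr0 -(subrr (k * beta)) {2}Eb Ek /slope.
  by rewrite !rmorphN rmorphD /=; ring.
move/eqP: d0; rewrite oppr_eq0 => /eqP d0.
have Ekc : k = phi c * l by rewrite Ek /slope d0 rmorph0 mul0r subr0 mulrC.
by exists c => //; apply: contraNneq k0 => c0; rewrite Ekc c0 rmorph0 mul0r.
Qed.

Lemma cover_plane_infE k (T : {vspace V}) : k != 0 ->
    (forall y, y \in T <-> exists m, y = g m 0) ->
  (cover_plane k :&: T = <[g k 0%R]> + <[(g (k * beta) 0)%R]>)%VS.
Proof.
move=> k0 memT; apply/vspaceP => y; apply/memv_capP/idP => [[]|yl].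
  move=> /mem_vlineD3[c [d [a ->]]] /memT[m E]; move: (E).
  rewrite {1}coord_map_comb => /coord_map_inj[_ /eqP].
  rewrite mulf_eq0 (negPf k0) /= fmorph_eq0.
  by move=> /eqP->; rewrite scale0r addr0; apply/mem_vlineD; exists c, d.
split; first by apply: subvP yl; apply: addvSl.
move: yl => /mem_vlineD[c [d ->]]; apply/memT.
exists (phi c * k + phi d * (k * beta)).
by rewrite -!gZ -gD !mulr0 add0r.
Qed.

Lemma dim_cover_plane_inf k (T : {vspace V}) : k != 0 ->
    (forall y, y \in T <-> exists m, y = g m 0) ->
  \dim (cover_plane k :&: T) = 2.
Proof.
move=> k0 memT; rewrite (cover_plane_infE k0 memT).
rewrite dim_vlineD //; first by apply: contraNneq k0 => /g_eq0[-> _].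
apply/vlineP => -[c]; rewrite -gZ => /coord_map_inj[E _].
case/negP: beta_notin; apply/codomP; exists c.
by apply: (mulfI k0); rewrite E mulrC.
Qed.

(** A vector [g (k * u) (k * phi a)] of the cover plane lies in [Q] only if [u = phi a * slope c d],
    so it is an [F]-multiple of [g (k * slope c d) k]. *)
Lemma dim_cover_plane_slope k c d (Q : {vspace V}) : k != 0 ->
    (forall y, y \in Q <-> exists m, y = g (m * slope c d) m) ->
  \dim (cover_plane k :&: Q) = 1.
Proof.
move=> k0 memQ; set x := g (k * slope c d) k.
have x0 : x != 0 by apply: contraNneq k0 => /g_eq0[_ ->].
suff -> : (cover_plane k :&: Q = <[x]>)%VS by rewrite dim_vline x0.
apply/vspaceP => y; apply/memv_capP/vlineP => [[]|[a ->]]; last first.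
  split; apply: memvZ; last by apply/memQ; exists k.
  by apply/mem_cover_plane; exists c, d, 1; rewrite rmorph1 mulr1.
move=> /mem_cover_plane[c' [d' [a ->]]] /memQ[m /coord_map_inj[E Em]].
rewrite -Em in E.
exists a; rewrite -gZ E; congr (g _ _); ring.
Qed.


(* Three vectors [w / h1], [w / h2], [w / h3] of a two-dimensional space are
   linearly dependent; with a linear relation between the [h]'s this makes
   [h2 / h1] a root of a quadratic polynomial. *)
Lemma no_three_slopes (p1 p2 p3 : F) (h1 h2 h3 w : K) c1 d1 c2 d2 c3 d3 :
    h1 != 0 -> h2 != 0 -> w != 0 -> p2 != 0 ->
    h2 / h1 \notin codom phi -> h3 / h2 \notin codom phi ->
    phi p1 * h1 + phi p2 * h2 + phi p3 * h3 = 0 ->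
    w = h1 * slope c1 d1 -> w = h2 * slope c2 d2 -> w = h3 * slope c3 d3 ->
  False.
Proof.
move=> h10 h20 w0 p20 h21 h32 lin E1 E2 E3.
(* If this determinant vanished, the second and third slopes would be proportional over [F], and
   then so would [h2] and [h3]. *)
have a1_neq0 : c2 * d3 - c3 * d2 != 0.
  apply/eqP => det0.
  have comb (x y : F) : x * c2 = y * c3 -> x * d2 = y * d3 -> - y = 0 /\ x = 0.
    move=> Ec Ed; apply: (rmorph_indep h20 h32).
    apply: (mulfI w0); rewrite mulr0 rmorphN.
    have S : phi x * slope c2 d2 = phi y * slope c3 d3.
      by rewrite /slope !mulrBr !mulrA -!rmorphM Ec Ed.
    have <- : h2 * h3 * (phi x * slope c2 d2 - phi y * slope c3 d3) = 0.
      by rewrite S subrr mulr0.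
    by rewrite mulrDr {1}E3 {1}E2; ring.
  have det : c3 * d2 = c2 * d3.
    by apply/esym/eqP; rewrite -subr_eq0 det0.
  have [/eqP c20 _] := comb c3 c2 (mulrC _ _) det.
  have [/eqP d20 _] : - d2 = 0 /\ d3 = 0.
    by apply: comb; rewrite 1?mulrC // [RHS]mulrC det.
  move: c20 d20; rewrite !oppr_eq0 => /eqP c20 /eqP d20.
  by move: w0; rewrite E2 /slope c20 d20 !rmorph0 mul0r subrr mulr0 eqxx.
(* The minors of the three pairs [(c1, d1)], [(c2, d2)], [(c3, d3)] are the coefficients of a linear
   relation among them. *)
pose a1 := c2 * d3 - c3 * d2; pose a2 := c3 * d1 - c1 * d3.
pose a3 := c1 * d2 - c2 * d1.
have S0 : phi a1 * slope c1 d1 + phi a2 * slope c2 d2 + phi a3 * slope c3 d3 = 0.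
  by rewrite /slope /a1 /a2 /a3 !(rmorphB, rmorphM) /=; ring.
rewrite -/a1 in a1_neq0; clearbody a1 a2 a3.
move: (slope c1 d1) (slope c2 d2) (slope c3 d3) E1 E2 E3 S0.
move=> u1 u2 u3 E1 E2 E3 S0.
(* Since [u1 = w / h1] and so on, this is [S0] multiplied by [h1 * h2 * h3] and divided by [w]. *)
have Q0 : phi a1 * (h2 * h3) + phi a2 * (h1 * h3) + phi a3 * (h1 * h2) = 0.
  apply: (mulfI w0); rewrite mulr0 -(mulr0 (h1 * h2 * h3)) -S0.
  by rewrite !mulrDr {1}E1 {1}E2 {1}E3; ring.
(* Eliminating [h3] between [lin] and [Q0] and dividing by [h1 ^+ 2] gives a quadratic equation for
   [h2 / h1] with leading coefficient [a1 * p2]. *)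
have [] : [/\ a1 * p2 = 0, a1 * p1 + a2 * p2 - a3 * p3 = 0 & a2 * p1 = 0].
  apply: (quadratic_rmorph_eq0 cardK h21).
  have h11 : h1 ^+ 2 != 0 by rewrite expf_neq0.
  apply: (mulfI h11); rewrite mulr0.
  transitivity ((phi a1 * h2 + phi a2 * h1) *
      (phi p1 * h1 + phi p2 * h2 + phi p3 * h3) - phi p3 *
      (phi a1 * (h2 * h3) + phi a2 * (h1 * h3) + phi a3 * (h1 * h2))).
    by rewrite rmorphB rmorphD !rmorphM; field.
  by rewrite lin Q0 !mulr0 subrr.
by move=> /eqP; rewrite mulf_eq0 (negPf a1_neq0) (negPf p20).
Qed.

(** * Completeness and size of the family *)

Hypothesis F_gt2 : (2 < #|F|)%N.

Lemma slopeB c d c' d' : slope c d - slope c' d' = slope (c - c') (d - d').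
Proof. by rewrite /slope !rmorphB; ring. Qed.

Lemma slopeZ a c d : phi a * slope c d = slope (a * c) (a * d).
Proof. by rewrite /slope !rmorphM; ring. Qed.

(* [h] runs over representatives of the points of the line spanned by [k] and
   [l] over [F], and each [slope] value gives a coefficient [(r p).2]. *)
Lemma no_large_fibres (k l w : K) (r : F * F -> option F * F)
    (h A : option F -> K) :
    k != 0 -> w != 0 -> l / k \notin codom phi ->
    (forall o, h o = if o is Some s then k + phi s * l else l) ->
    (forall p, slope p.1 p.2 * h (r p).1 = A (r p).1 + phi (r p).2 * w) ->
  False.
Proof.
move=> k0 w0 lk hE rE.
(* [x] and [y] are homogeneous coordinates on the line spanned by [k] and [l], with [None] for the
   point of [l]. *)
pose x (o : option F) : F := if o is Some s then 1 else 0.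
pose y (o : option F) : F := if o is Some s then s else 1.
have hxy o : h o = phi (x o) * k + phi (y o) * l.
  by rewrite hE; case: o => [s|] /=; rewrite ?rmorph1 ?rmorph0 ?mul0r ?mul1r ?add0r.
have h0 o : h o != 0.
  rewrite hxy; apply/eqP => /(rmorph_indep k0 lk).
  by case: o => [s|] /= [] /eqP; rewrite ?oner_eq0 // => _ /eqP; rewrite oner_eq0.
pose det o o' := x o * y o' - x o' * y o.
have det0 o o' : o != o' -> det o o' != 0.
  rewrite /det; case: o o' => [s|] [s'|] //=; rewrite ?mul1r ?mul0r ?mulr1.
  - by rewrite subr_eq0 eq_sym.
  - by rewrite subr0 oner_eq0.
  by rewrite sub0r oppr_eq0 oner_eq0.
have ratio o o' : o != o' -> h o' / h o \notin codom phi.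
  move=> /det0; apply: contra => /codomP[c Ec].
  have E : h o' = phi c * h o by rewrite -Ec divfK.
  have [Ex Ey] : x o' - c * x o = 0 /\ y o' - c * y o = 0.
    apply: (rmorph_indep k0 lk); rewrite !rmorphB !rmorphM.
    by rewrite -(subrr (h o')) {2}E !hxy; ring.
  rewrite /det (_ : _ - _ = x o * (y o' - c * y o) - y o * (x o' - c * x o)).
    by rewrite Ex Ey !mulr0 subrr.
  by ring.
(* Equal values of [r] give equal right-hand sides in [rE], and the nonzero factor [h] cancels. *)
have injr : injective r.
  move=> [c d] [c' d'] E; have := rE (c, d); rewrite E -rE /= => /(mulIf (h0 _)).
  move/eqP; rewrite -subr_eq0 slopeB => /eqP/slope_eq0[/eqP + /eqP].
  by rewrite !subr_eq0 => /eqP-> /eqP->.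
have [||||o1 [o2 [o3 [[n12 n23 n31] big]]]] := three_large_fibres (n := #|F|) injr.
- by rewrite card_prod.
- by rewrite card_option.
- by [].
- by [].
(* Two slopes in one fibre share the term [A]; subtracting their equations expresses [w] as [h o]
   times a slope. *)
have large o : o \in [:: o1; o2; o3] -> exists c d, w = h o * slope c d.
  move=> /big[[c d] [[c' d'] [neq Eo Eo']]].
  have E : h o * slope (c - c') (d - d') =
      phi ((r (c, d)).2 - (r (c', d')).2) * w.
    have := rE (c, d); have := rE (c', d'); rewrite /= Eo Eo' => E' E.
    rewrite -slopeB mulrC mulrBl E E' rmorphB; ring.
  set a := (r (c, d)).2 - _ in E.
  have a0 : a != 0.
    apply: contraNneq neq => a0; move/eqP: E; rewrite a0 rmorph0 mul0r.
    rewrite mulf_eq0 (negPf (h0 o)) /= => /eqP/slope_eq0[/eqP + /eqP].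
    by rewrite !subr_eq0 => /eqP-> /eqP->.
  exists (a^-1 * (c - c')), (a^-1 * (d - d')).
  rewrite -slopeZ mulrCA E mulrA -rmorphM mulVf // rmorph1 mul1r //.
have [c1 [d1 E1]] : exists c d, w = h o1 * slope c d.
  by apply: large; rewrite mem_head.
have [c2 [d2 E2]] : exists c d, w = h o2 * slope c d.
  by apply: large; rewrite !inE eqxx orbT.
have [c3 [d3 E3]] : exists c d, w = h o3 * slope c d.
  by apply: large; rewrite !inE eqxx !orbT.
(* Again the minors give the linear relation, here among the three vectors [h o1], [h o2], [h o3] of
   a plane. *)
apply: (@no_three_slopes (det o2 o3) (det o3 o1) (det o1 o2)
  (h o1) (h o2) (h o3) w
  c1 d1 c2 d2 c3 d3 (h0 o1) (h0 o2) w0) => //; rewrite ?det0 ?ratio //.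
by rewrite !hxy /det !rmorphB !rmorphM; ring.
Qed.

(** Each slope [u] provides a vector of [P] with second coordinate [kf p]. If all of these are
    [F]-multiples of [k], then [P] contains every [g (k * u) k], hence the differences [g (k * u) 0]
    and the whole cover plane of [k]. Otherwise some [l = kf p0] completes a basis of [P], and
    [no_large_fibres] gives a contradiction. *)
Lemma cover_plane_unique (P : {vspace V}) :
    \dim P = 3 -> (exists2 w, w != 0 & g w 0 \in P) ->
    (forall c d, exists2 k, k != 0 & g (k * slope c d) k \in P) ->
  exists2 k, k != 0 & P = cover_plane k.
Proof.
move=> dimP [w w0 Pw] meetP.
have kex (p : F * F) : exists k, k != 0 /\ g (k * slope p.1 p.2) k \in P.
  by have [k] := meetP p.1 p.2; exists k.
have [kf kfP] := fin_all_exists kex.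
have slope0 : slope 0 0 = 0 by rewrite /slope !rmorph0 mul0r subrr.
pose k := kf (0, 0); have [k0 Pk] : k != 0 /\ g 0 k \in P.
  by have := kfP (0, 0); rewrite /= slope0 mulr0.
exists k => //.
have [allk|] := boolP [forall p, kf p / k \in codom phi].
  have Pslope c d : g (k * slope c d) k \in P.
    have /codomP[a Ea] := forallP allk (c, d); have [n0 Pn] := kfP (c, d).
    have En : kf (c, d) = phi a * k by rewrite -Ea divfK.
    have a0 : a != 0 by apply: contraNneq n0 => a0; rewrite En a0 rmorph0 mul0r.
    by rewrite -(scalerK a0 (g _ _)) memvZ // -gZ mulrA -En.
  have Pslope0 c d : g (k * slope c d) 0 \in P.
    have -> : g (k * slope c d) 0 = g (k * slope c d) k - g 0 k.
      by rewrite -coord_mapN -gD oppr0 addr0 subrr.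
    exact: memvB.
  apply/esym/eqP; rewrite eqEdim dimP dim_cover_plane // andbT.
  rewrite !subv_add -!memvE Pk andbT; apply/andP; split.
    have -> : k = k * slope 1 0 by rewrite /slope rmorph1 rmorph0 mul0r subr0 mulr1.
    exact: Pslope0.
  have -> : beta = slope 0 (- 1).
    by rewrite /slope rmorph0 rmorphN rmorph1 mulN1r opprK add0r.
  exact: Pslope0.
rewrite negb_forall => /existsP[p0 lk]; exfalso.
have [l0 Pl] := kfP p0; set l := kf p0 in lk l0 Pl; set v := slope _ _ in Pl.
have comb a b c : a *: g w 0 + b *: g 0 k + c *: g (l * v) l =
    g (phi a * w + phi c * (l * v)) (phi b * k + phi c * l).
  by rewrite -!gZ -!gD !mulr0 addr0 add0r.
have ind : indep3 (g w 0) (g 0 k) (g (l * v) l).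
  move=> a b c; rewrite comb => /g_eq0[+ /(rmorph_indep k0 lk)[-> c0]].
  rewrite c0 rmorph0 mul0r addr0 => /eqP.
  by rewrite mulf_eq0 fmorph_eq0 (negPf w0) orbF => /eqP->.
have defP : P = (<[g w 0%R]> + <[g 0%R k]> + <[(g (l * v) l)%R]>)%VS.
  by apply/esym/eqP; rewrite eqEdim dim_vlineD3 // dimP !subv_add -!memvE Pw Pk Pl.
pose h o := if o is Some s then k + phi s * l else l.
pose A o := if o is Some s then phi s * (l * v) else l * v.
(* The vector over [p] is divided by its coefficient at [g 0 k], or by the one at [g (l * v) l] when
   the former is zero; its second coordinate then becomes a value of [h]. *)
have rex p : exists oa : option F * F,
    slope p.1 p.2 * h oa.1 = A oa.1 + phi oa.2 * w.
  have [n0] := kfP p; rewrite {1}defP => /mem_vlineD3[a [b [c]]].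
  rewrite comb => /coord_map_inj[]; move: (kf p) n0 => m m0 Em1 Em2.
  have [b0|b0] := eqVneq b 0.
    rewrite b0 rmorph0 mul0r add0r in Em2.
    have c0 : phi c != 0.
      by apply: contraNneq m0 => c0; rewrite Em2 c0 mul0r.
    exists (None, a / c); rewrite /h /A /= fmorph_div.
    apply: (mulfI c0); transitivity (m * slope p.1 p.2); first by rewrite Em2; ring.
    by rewrite Em1; field; rewrite c0.
  have pb : phi b != 0 by rewrite fmorph_eq0.
  exists (Some (c / b), a / b); rewrite /h /A /= !fmorph_div.
  apply: (mulfI pb); transitivity (m * slope p.1 p.2).
    by rewrite Em2; field; rewrite pb.
  by rewrite Em1; field; rewrite pb.
have [r rP] := fin_all_exists rex.
exact: (@no_large_fibres k l w r h A k0 w0 lk).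
Qed.

Lemma cover_plane_eq k l : k != 0 -> l != 0 -> cover_plane k = cover_plane l ->
  exists2 c, c != 0 & k = phi c * l.
Proof.
move=> k0 l0 E; apply: cover_plane_proportional => //; rewrite -E.
  by rewrite /cover_plane memvE -addvA addvSl.
  by rewrite /cover_plane memvE [(<[g k 0%R]> + _)%VS]addvC -addvA addvSl.
Qed.

(** The nonzero [k] fall into classes of [#|F| - 1] proportional elements over [F], one class for
    each plane. *)
Lemma card_cover_planes :
  #|[set cover_plane k | k in [set~ 0]]| = (#|F| ^ 2 + #|F| + 1)%N.
Proof.
set C := [set _ | _ in _].
have fibre P : P \in C ->
    (\sum_(k in [set~ 0%R] | cover_plane k == P) 1 = #|F|.-1)%N.
  case/imsetP=> l; rewrite !inE => l0 ->.
  have injl : injective (fun c => phi c * l).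
    by move=> c d /(mulIf l0)/fmorph_inj.
  rewrite sum1dep_card -(cardC1 (0 : F)) -(card_imset _ injl).
  apply: eq_card => k; rewrite !inE; apply/andP/imsetP => [[k0 /eqP E]|[c c0 ->]].
    by have [c c0 ->] := cover_plane_eq k0 l0 E; exists c.
  by rewrite mulf_neq0 ?fmorph_eq0 // cover_planeZ.
have F_gt1 := ltnW F_gt2.
have : (#|F| ^ 3 - 1 = #|C| * (#|F| - 1))%N.
  rewrite -cardK !subn1 -(cardC1 (0 : K)) -sum_nat_const -(eq_bigr _ fibre).
  by rewrite -partition_big_imset sum1_card; apply: eq_card => k; rewrite !inE.
move: #|C| #|F| F_gt1 => a n n_gt1 E.
have n1 : (0 < n - 1)%N by rewrite subn_gt0.
apply/eqP; rewrite -(eqn_pmul2r n1) -E; apply/eqP; nia.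
Qed.

End Covers.

(** * Transfer to the Bruck-Bose representation *)

Lemma meetsP (n : nat) (L : finFieldType) (U W : PG n L) :
  reflect (exists x, [/\ x != 0, x \in U & x \in W]) (meets U W).
Proof.
rewrite /meets -vpick0; apply: (iffP idP) => [I0|[x [x0 Ux Wx]]].
  by exists (vpick (U :&: W)%VS); have /memv_capP[] := memv_pick (U :&: W)%VS.
rewrite vpick0; apply: contraNneq x0 => UW0.
by rewrite -memv0 -UW0 memv_cap Ux.
Qed.

Theorem theorem9p1 (q : nat) (F K : finFieldType)
    (cardF : #|F| = q) (cardK : #|K| = (q ^ 3)%N) (q_gt2 : (2 < q)%N)
    (linf : PG 2 K) (Sigma : PG 6 F) (S : {set PG 6 F})
    (bb : PG 2 K -> PG 6 F) (bbP : bruck_bose linf Sigma S bb)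
    (T : PG 2 K) (ST : {set PG 2 K}) (STP : tangent_splash q linf T ST) :
  let planesST : {set PG 6 F} := bb @: ST in
  let covers := cover_planes Sigma planesST in
  [/\ #|covers| = (q ^ 2 + q + 1)%N,
      {in covers, forall P, (P :&: bb T)%VS \in lines},
      {in covers &, injective (fun P => (P :&: bb T)%VS)},
      {in covers & planesST :\ bb T, forall P Q, (P :&: Q)%VS \in points}
    & {in covers, forall P, {in points_of P, forall X,
         exists2 Q, Q \in planesST & (X <= Q)%VS}}].
Proof.
move=> planesST covers; subst q.
have [e1 [e2 [beta [[e10 e21] deflinf defT betaq memST]]]] :=
  tangent_splash_coord (ltnW q_gt2) (bb_linf bbP) STP.
have [g [phi [gD g0 gZ gS bbg]]] := bruck_bose_coord bbP e10 e21 deflinf.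
have beta_notin : beta \notin codom phi.
  by apply: contra betaq => /codomP[c ->]; rewrite rmorph_expf_card.
pose slope c d := phi c - phi d * beta.
pose Q c d := bb <[slope c d *: e1 + e2]>%VS.
have memT y : y \in bb T <-> exists m, y = g m 0.
  have := @bbg 1 0; rewrite oner_eq0 scale1r scale0r addr0 -defT.
  move=> /(_ isT y) H; split.
    by move=> /H[m ->]; exists (m * 1); rewrite mulr0.
  by move=> [m E]; apply/H; exists m; rewrite E mulr0 mulr1.
have memQ c d y : y \in Q c d <-> exists m, y = g (m * slope c d) m.
  have := @bbg (slope c d) 1; rewrite oner_eq0 orbT scale1r => /(_ isT y) H.
  split; first by move=> /H[m ->]; exists m; rewrite mulr1.
  by move=> [m E]; apply/H; exists m; rewrite E mulr1.
have planesT : bb T \in planesST by apply: imset_f; apply/memST; left.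
have fixphi m : m ^+ #|F| = m -> exists c, m = phi c.
  by move=> /(expf_card_codom phi)/codomP.
have planesQ c d : Q c d \in planesST.
  apply: imset_f; apply/memST; right; exists (phi c), (phi d).
  by rewrite !rmorph_expf_card.
have planesP R : R \in planesST -> R = bb T \/ exists c d, R = Q c d.
  case/imsetP=> X /memST[->|[m [n [/fixphi[c ->] /fixphi[d ->] ->]]]] ->.
    by left; rewrite defT.
  by right; exists c, d.
pose cover := cover_plane g beta.
have memcover k y : y \in cover k <->
    exists c d a, y = g (k * slope c d) (k * phi a).
  exact: mem_cover_plane.
(* From left to right, the common vectors with [bb T] and with every [Q c d] are the input of
   [cover_plane_unique]; conversely, [g k 0] and [g (k * slope c d) k] are common vectors. *)
have defcovers : covers = [set cover k | k in [set~ 0]].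
  apply/setP => P; rewrite !inE; apply/andP/imsetP.
    move=> [/andP[/eqP dimP sP] /forallP meetP].
    have meetR R : R \in planesST ->
        exists y, [/\ y != 0, y \in P & y \in R].
      by move=> pR; apply/meetsP; apply: (implyP (meetP R)).
    have [||k k0 ->] := cover_plane_unique cardK gD g0 gZ beta_notin q_gt2 dimP.
    - have [y [y0 Py /memT[w Ew]]] := meetR _ planesT.
      exists w; last by rewrite -Ew.
      by apply: contraNneq y0 => w0; rewrite Ew w0 (coord_map0 gD).
    - move=> c d; have [y [y0 Py /memQ[k Ek]]] := meetR _ (planesQ c d).
      exists k; last by rewrite -Ek.
      by apply: contraNneq y0 => k0; rewrite Ek k0 mul0r (coord_map0 gD).
    by exists k; rewrite ?inE.
  move=> [k]; rewrite !inE => k0 ->.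
  rewrite (dim_cover_plane gD g0 gZ beta_notin k0) eqxx /= !subv_add -!memvE !gS.
  split=> //; apply/forallP => R; apply/implyP => /planesP[->|[c [d ->]]].
    apply/meetsP; exists (g k 0); split; last by apply/memT; exists k.
      by apply: contraNneq k0 => /g0[-> _].
    apply/memcover; exists 1, 0, 0.
    by rewrite /slope rmorph1 rmorph0 mul0r subr0 mulr1 mulr0.
  apply/meetsP; exists (g (k * slope c d) k).
  split; last by apply/memQ; exists k.
    by apply: contraNneq k0 => /g0[_ ->].
  by apply/memcover; exists c, d, 1; rewrite rmorph1 mulr1.
have coverP P : P \in covers -> exists2 k, k != 0 & P = cover k.
  by rewrite defcovers => /imsetP[k]; rewrite !inE; exists k.
split.
- rewrite defcovers.
  exact: (card_cover_planes cardK gD g0 gZ beta_notin q_gt2).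
- move=> P /coverP[k k0 ->]; rewrite inE.
  by rewrite (dim_cover_plane_inf gD g0 gZ beta_notin k0 memT).
- move=> P P' /coverP[k k0 ->] /coverP[l l0 ->] E.
  have infE m := @cover_plane_infE _ _ _ _ _ _ gD g0 gZ m (bb T).
  move: E; rewrite /= !infE // => E.
  have sub m : (<[g m 0%R]> + <[(g (m * beta) 0)%R]> <= cover m)%VS.
    exact: addvSl.
  (* Both generators of the trace of [cover k] lie in [cover l]. *)
  have [c c0 ->] : exists2 c, c != 0 & k = phi c * l.
    apply: (cover_plane_proportional cardK gD g0 gZ beta_notin k0 l0);
      apply: (subvP (sub l)); rewrite -E memvE.
      exact: addvSl.
    exact: addvSr.
  exact: cover_planeZ.
- move=> P R /coverP[k k0 ->] /setD1P[RT /planesP[E|[c [d ->]]]].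
    by rewrite E eqxx in RT.
  by rewrite inE (dim_cover_plane_slope gD g0 gZ k0 (memQ c d)).
move=> P /coverP[k k0 ->] X; rewrite inE => /andP[/pointsP[x x0 ->]].
rewrite -memvE => /memcover[c [d [a ->]]].
(* For [a = 0] the vector lies in [bb T]; otherwise, with [m = k * phi a], it is
   [g (m * slope (c / a) (d / a)) m]. *)
have [->|a0] := eqVneq a 0.
  exists (bb T) => //; rewrite -memvE rmorph0 mulr0.
  by apply/memT; exists (k * slope c d).
exists (Q (c / a) (d / a)) => //; rewrite -memvE; apply/memQ.
have pa : phi a != 0 by rewrite fmorph_eq0.
exists (k * phi a); congr (g _ _).
by rewrite /slope !fmorph_div; field.
Qed.
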